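(* Let $(X_k)_{k\in\mathbb N}$ be a strictly stationary, aperiodic and irreducible Markov chain with finite state space $\mathcal X$, and let $U_n(h)(X)$ be a non-degenerate U-statistic based on a bounded symmetric kernel $h:\mathcal X^2\to\mathbb R$ of degree two. Let $(a_n)_n$ be a sequence of positive reals with $$\lim_{n\to\infty}\frac{a_n}{n}=0\quad\text{and}\quad\lim_{n\to\infty}\frac{n}{a_n^2}=0 .$$ Then the sequence $\left(\frac{n}{a_n}\bigl(U_n(h)(X)-\mathbb E[U_n(h)(X)]\bigr)\right)_n$ satisfies the moderate deviation principle with speed $s_n=\frac{a_n^2}{n}$ and rate function $$I(x)=\sup_{\lambda\in\mathbb R}\left\{\lambda x-\frac{\lambda^2}{2}\lim_{n\to\infty}\mathbb V\left(\sqrt n\,U_n(h)(X)\right)\right\}.$$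
   Context: The U-statistic of degree two with kernel $h$ is $$U_n(h)(X):=\frac1{\binom n2}\sum_{1\le i<j\le n}h(X_i,X_j).$$ $\mathbb V$ denotes variance. Non-degenerate means $\sigma_1^2:=\mathbb V[h_1(X_1)]>0$, where $h_1(x):=\mathbb E[h(x,X_1)]$ (expectation under the stationary distribution of the chain, with $x$ fixed). A sequence of real random variables with laws $\mu_n$ satisfies the moderate deviation principle (formally a large deviation principle) with speed $s_n\to\infty$ and good rate function $I$ if the level sets $\{x: I(x)\le\alpha\}$ are compact for all $\alpha\in[0,\infty)$ and for all Borel sets $\Gamma$, $$-\inf_{x\in \mathrm{int}(\Gamma)}I(x)\le\liminf_{n\to\infty}\frac1{s_n}\log\mu_n(\Gamma)\le\limsup_{n\to\infty}\frac1{s_n}\log\mu_n(\Gamma)\le-\inf_{x\in \mathrm{cl}(\Gamma)}I(x).$$ *)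

(* Defs.v *)
From HB Require Import structures.
From mathcomp Require Import all_boot all_order all_algebra.
From mathcomp Require Import all_classical all_reals all_analysis.

Set Implicit Arguments.
Unset Strict Implicit.
Unset Printing Implicit Defensive.

Import Order.TTheory GRing.Theory Num.Theory.
Import numFieldNormedType.Exports.

Local Open Scope classical_set_scope.
Local Open Scope ring_scope.

Section FiniteChain.
Context (R : realType) (S : finType).
Implicit Type p : S -> S -> R.

Definition stochastic p : Prop :=
  (forall x y, 0 <= p x y) /\ (forall x, \sum_(y : S) p x y = 1).

Fixpoint nstep p (n : nat) (x y : S) : R :=
  if n is m.+1 then \sum_(z : S) p x z * nstep p m z y else (x == y)%:R.

Definition irreducible_chain p : Prop :=
  forall x y, exists n : nat, 0 < nstep p n x y.

(* gcd {n >= 1 | p^n(x,x) > 0} = 1: the only common divisor is 1; an empty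
   set of return times is excluded, since then every d would have to be 1 *)
Definition aperiodic_chain p : Prop :=
  forall (x : S) (d : nat),
    (forall n : nat, (0 < n)%N -> 0 < nstep p n x x -> (d %| n)%N) -> d = 1%N.

End FiniteChain.

(* Processes are indexed from 0: X k stands for the variable usually written
   X_{k+1}, so that U_n is built from X 0, ..., X n.-1. *)
Section Process.
Context d (Omega : measurableType d) (R : realType) (P : probability Omega R).
Context (S : finType).
Implicit Type X : nat -> Omega -> S.

(* S carries the discrete sigma-algebra *)
Definition discrete_process X : Prop :=
  forall k s, measurable (X k @^-1` [set s]).

(* P(X_0 = x_0, .., X_n = x_n, X_{n+1} = y)
     = P(X_0 = x_0, .., X_n = x_n) p(x_n, y),
   i.e. the Markov property with the conditional probability multiplied out,
   which also covers conditioning events of probability 0 *)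
Definition markov_chain X (p : S -> S -> R) : Prop :=
  [/\ discrete_process X, stochastic p &
    forall (n : nat) (x : nat -> S) (y : S),
      P [set w | (forall i, (i <= n)%N -> X i w = x i) /\ X n.+1 w = y] =
      (P [set w | forall i, (i <= n)%N -> X i w = x i] * (p (x n) y)%:E)%E].

Definition strictly_stationary X : Prop :=
  forall (k m : nat) (t : 'I_m -> nat) (x : 'I_m -> S),
    P [set w | forall i, X (t i + k)%N w = x i] =
    P [set w | forall i, X (t i) w = x i].

Definition Ustat (h : S -> S -> R) X (n : nat) (w : Omega) : R :=
  ('C(n, 2)%:R)^-1 *
  \sum_(i < n) \sum_(j < n | (i < j)%N) h (X i w) (X j w).

Definition Ustat_h1 (h : S -> S -> R) X (x : S) : R :=
  fine ('E_P[fun w => h x (X 0%N w)])%E.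

Definition nondegenerate_Ustat (h : S -> S -> R) X : Prop :=
  (0 < 'V_P[fun w => Ustat_h1 h X (X 0%N w)])%E.

End Process.

Section LargeDeviations.
Context (R : realType).
Local Open Scope ereal_scope.

Definition good_rate (I : R -> \bar R) : Prop :=
  forall alpha : R, (0 <= alpha)%R -> compact [set x | I x <= alpha%:E].

(* lne 0 = -oo and ereal_inf set0 = +oo *)
Definition moderate_deviation_principle
    (mu : nat -> set R -> \bar R) (s : nat -> R) (I : R -> \bar R) : Prop :=
  [/\ s @ \oo --> (+oo)%R, good_rate I &
    forall G : set R, measurable G ->
      [/\ - ereal_inf (I @` interior G)
            <= limn_einf (fun n => ((s n)^-1)%:E * lne (mu n G)),
          limn_einf (fun n => ((s n)^-1)%:E * lne (mu n G))
            <= limn_esup (fun n => ((s n)^-1)%:E * lne (mu n G)) &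
          limn_esup (fun n => ((s n)^-1)%:E * lne (mu n G))
            <= - ereal_inf (I @` closure G)]].

(* I(x) = sup_lambda (lambda x - lambda^2 / 2 * v); it takes the value +oo
   at every x <> 0 when v = 0 *)
Definition gaussian_rate (v : R) (x : R) : \bar R :=
  ereal_sup [set (l * x - l ^+ 2 / 2 * v)%:E | l in [set: R]].

End LargeDeviations.

(* Main.v *)
Require Import Defs.
From HB Require Import structures.
From mathcomp Require Import all_boot all_order all_algebra.
From mathcomp Require Import all_classical all_reals all_analysis.
From mathcomp Require Import ring lra.

(* Hoeffding's decomposition splits [n * (U_n - theta)] into the additive functional
   [path_sum (linear_part pi h)] of the path and a remainder.  As the state space is finite,
   the degenerate part of the kernel gives a quadratic form in the centered occupation numbers
   [path_sum (centered_visit pi x)], divided by [n]; these have Gaussian exponential moments,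
   so the remainder is negligible both in [L^2] and, at the scale [a n], with
   superexponentially small probability.

   For a centered function [f], Poisson's equation [g - transition p g = f] makes
   [path_sum f] a martingale up to a bounded term, with increments of conditional variance
   [cond_var p g]; solving Poisson's equation once more for the centered conditional variance
   gives an approximate eigenvector of the exponentially tilted kernel, hence
   [E exp (t * path_sum f) = exp (n * (t ^+ 2 / 2 * v + O (`|t| ^+ 3)) + O (1))] uniformly in
   small [t].  With [t = l * a n / n] this is the quadratic limit of the scaled logarithmic
   moment generating functions, and the Gärtner-Ellis theorem applies. *)

Set Implicit Arguments.
Unset Strict Implicit.
Unset Printing Implicit Defensive.

Import Order.TTheory GRing.Theory Num.Theory.
Import numFieldNormedType.Exports.

Local Open Scope classical_set_scope.
Local Open Scope ring_scope.

(** The two conditions on [a] answer the two errors in the Laplace asymptotics. For the speed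
    [s n = a n ^+ 2 / n], the cubic term [n * |t| ^+ 3] is [s n] times [|l| ^+ 3 * a n / n], and the
    [O (1)] is negligible because [s n] tends to infinity. The first condition also disposes of the
    quadratic remainder: to reach the scale [a n], a squared occupation deviation must be of order
    [n * a n]; this has probability at most of order [exp (- c * a n)], and [a n] is much larger
    than [s n]. The limit variance [v] can vanish, since a nonconstant function may have additive
    functionals that stay bounded along the path. The rate is then infinite off 0. For this reason
    the statements avoid division by [v]: points of finite rate are written [l * v], level sets
    [x ^+ 2 <= 2 * v * alpha]. The estimates concern finite sums over tuples weighted by
    [path_weight]; measure theory enters through the identification of the law of the process with
    these weights. *)

(** * The Gaussian rate function and its level sets *)

Section GaussianRate.
Context (R : realType).
Implicit Types v x alpha : R.

(** For [v > 0] the supremum is attained at [l = x / v]. For [v = 0] it is that of a linear function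
    of [l], which passes [alpha] at [l = (alpha + 1) / x] unless [x = 0]. *)
Lemma gaussian_rate_leP v x alpha : 0 <= v -> 0 <= alpha ->
  reflect (x ^+ 2 <= 2 * v * alpha) (gaussian_rate v x <= alpha%:E)%E.
Proof.
move=> v0 al0; apply: (iffP idP) => [h|h].
  have hl l : l * x - l ^+ 2 / 2 * v <= alpha.
    by rewrite -lee_fin; apply: le_trans h; apply: ereal_sup_ubound; exists l.
  have [v_eq0|vn0] := eqVneq v 0.
    have [->|xn0] := eqVneq x 0; first by rewrite v_eq0 expr0n !(mulr0, mul0r).
    have := hl ((alpha + 1) / x).
    by rewrite v_eq0 mulr0 subr0 divfK// gerDl ler10.
  have vp : 0 < v by rewrite lt0r vn0.
  have := hl (x / v).
  have -> : x / v * x - (x / v) ^+ 2 / 2 * v = x ^+ 2 / (2 * v) by field.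
  by rewrite ler_pdivrMr ?mulr_gt0// [alpha * _]mulrC.
apply: ge_ereal_sup => _ [l _ <-]; rewrite lee_fin.
have [v_eq0|vn0] := eqVneq v 0.
  move: h; rewrite v_eq0 mulr0 mul0r => h.
  have : x ^+ 2 == 0 by rewrite eq_le h sqr_ge0.
  by rewrite sqrf_eq0 => /eqP ->; rewrite !mulr0 subr0.
have vp : 0 < v by rewrite lt0r vn0.
have : 2 * v * (l * x - l ^+ 2 / 2 * v) <= 2 * v * alpha.
  by apply: le_trans h; have := sqr_ge0 (x - l * v); nra.
by rewrite ler_pM2l// mulr_gt0.
Qed.

Lemma good_rate_gaussian v : 0 <= v -> good_rate (gaussian_rate v).
Proof.
move=> v0 alpha al0.
have va0 : 0 <= 2 * v * alpha by rewrite !mulr_ge0.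
suff -> : [set x | (gaussian_rate v x <= alpha%:E)%E] =
    [set` `[- Num.sqrt (2 * v * alpha), Num.sqrt (2 * v * alpha)]].
  exact: segment_compact.
apply/seteqP; split=> x /=; rewrite in_itv/= -ler_norml -sqrtr_sqr.
  by move=> /(gaussian_rate_leP _ v0 al0) ?; rewrite ler_sqrt.
by rewrite ler_sqrt// => ?; apply/gaussian_rate_leP.
Qed.

End GaussianRate.

(** * Upper and lower limits of extended real sequences *)

Section LimnEreal.
Context (R : realType).
Local Open Scope ereal_scope.
Implicit Types (u : nat -> \bar R) (c : \bar R).

Lemma limn_esup_le_near u c :
  (\forall n \near \oo, u n <= c) -> limn_esup u <= c.
Proof.
move=> h; rewrite /limn_esup /limf_esup.
apply: (@le_trans _ _ (ereal_sup (u @` [set n | u n <= c]))).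
  by apply: ereal_inf_lbound; exists [set n | u n <= c].
by apply: ge_ereal_sup => _ [n hn <-].
Qed.

Lemma limn_einf_ge_near u c :
  (\forall n \near \oo, c <= u n) -> c <= limn_einf u.
Proof.
move=> h; rewrite /limn_einf leeNr; apply: limn_esup_le_near.
by apply: filterS h => n; rewrite leeN2.
Qed.

(** Serves the upper bound with [y] the infimum of the rate: working below every real level [r < y]
    treats finite and infinite infima alike. *)
Lemma le_oppe_real (x y : \bar R) :
  (forall r : R, r%:E < y -> x <= (- r)%:E) -> x <= - y.
Proof.
case: y => [y| |] h /=; last by rewrite leey.
  apply/lee_addgt0Pr => e e0.
  by have := h (y - e)%R; rewrite lte_fin gtrBl e0 opprB addrC EFinD; exact.
case: x h => [x| |] h //; last by have := h 0%R (ltry _).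
by have := h (1 - x)%R (ltry _); rewrite lee_fin opprB lerBrDl gerDr ler10.
Qed.

End LimnEreal.

(** * Expectations and probabilities as finite weighted sums *)

Section FiniteExpectation.
Context (R : realType) (T : finType) (mu : T -> R).
Hypothesis mu_ge0 : forall t, 0 <= mu t.
Implicit Types (F G : T -> R) (A B C : pred T).

Definition fexp F : R := \sum_t mu t * F t.
Definition fprob A : R := \sum_(t | A t) mu t.

Lemma le_fexp F G : (forall t, F t <= G t) -> fexp F <= fexp G.
Proof. by move=> h; apply: ler_sum => t _; apply: ler_wpM2l. Qed.

Lemma fexp_ge0 F : (forall t, 0 <= F t) -> 0 <= fexp F.
Proof. by move=> h; apply: sumr_ge0 => t _; apply: mulr_ge0. Qed.

Lemma fexpD F G : fexp (fun t => F t + G t) = fexp F + fexp G.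
Proof. by rewrite -big_split; apply: eq_bigr => t _; rewrite mulrDr. Qed.

Lemma fexpZ c F : fexp (fun t => c * F t) = c * fexp F.
Proof. by rewrite mulr_sumr; apply: eq_bigr => t _; rewrite mulrCA. Qed.

Lemma fexp_cst c : fexp (fun=> c) = c * \sum_t mu t.
Proof. by rewrite mulr_sumr; apply: eq_bigr => t _; rewrite mulrC. Qed.

Lemma fexp_sum (I : finType) (F : I -> T -> R) :
  fexp (fun t => \sum_i F i t) = \sum_i fexp (F i).
Proof. by rewrite exchange_big; apply: eq_bigr => t _; rewrite mulr_sumr. Qed.

Lemma fprobE A : fprob A = fexp (fun t => (A t)%:R).
Proof.
by rewrite /fprob big_mkcond; apply: eq_bigr => t _; case: (A t);
  rewrite ?mulr1 ?mulr0.
Qed.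

Lemma fprob_leD A B C : (forall t, A t -> B t || C t) ->
  fprob A <= fprob B + fprob C.
Proof.
move=> h; rewrite !fprobE -fexpD; apply: le_fexp => t; move: (h t).
by case: (A t) (B t) (C t) => [] [] [] //= h'; [lra|lra|lra|have := h' isT|lra..].
Qed.

Lemma le_fprob A B : (forall t, A t -> B t) -> fprob A <= fprob B.
Proof.
move=> h; rewrite !fprobE; apply: le_fexp => t; move: (h t).
by case: (A t) (B t) => [] [] //= h'; have := h' isT.
Qed.

Lemma fprob_markov A F c : (forall t, 0 <= F t) -> (forall t, A t -> c <= F t) ->
  c * fprob A <= fexp F.
Proof.
move=> F0 h; rewrite fprobE -fexpZ; apply: le_fexp => t; move: (h t).
by case: (A t) => h'; rewrite ?mulr1 ?mulr0//; apply: h'.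
Qed.

End FiniteExpectation.

(** * Gärtner-Ellis theorem for a quadratic limit *)

Section GartnerEllis.
Context (R : realType) (T : nat -> finType) (mu : forall n, T n -> R).
Arguments mu : clear implicits.
Hypothesis mu_ge0 : forall n t, 0 <= mu n t.
Hypothesis mu_sum1 : forall n, \sum_t mu n t = 1.
Context (s : nat -> R) (v : R).
Hypothesis s_infty : s @ \oo --> +oo.
Hypothesis v_ge0 : 0 <= v.
Context (W Z : forall n, T n -> R).
Arguments W : clear implicits.
Arguments Z : clear implicits.
Hypothesis W_laplace : forall l e : R, 0 < e -> \forall n \near \oo,
  expR (s n * (l ^+ 2 / 2 * v - e)) <= fexp (mu n) (fun t => expR (l * s n * W n t))
    <= expR (s n * (l ^+ 2 / 2 * v + e)).
Hypothesis ZW_equiv : forall e K : R, 0 < e -> \forall n \near \oo,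
  fprob (mu n) (fun t => e <= `|Z n t - W n t|) <= expR (- s n * K).

Let s_ge (c : R) : \forall n \near \oo, c <= s n.
Proof. by move/cvgryPge : s_infty; exact. Qed.

(** Any loss in the exponential rate pays for a constant factor, because [exp (s n * (r - r'))] is
    at least [s n * (r - r')] and [s n] tends to infinity. *)
Lemma absorb_constant (C r r' : R) : r' < r -> \forall n \near \oo,
  C * expR (- s n * r) <= expR (- s n * r').
Proof.
move=> rr'; near=> n.
rewrite -ler_pdivlMr ?expR_gt0// -expRN -expRD.
have -> : - s n * r' + - (- s n * r) = s n * (r - r') by ring.
apply: (le_trans _ (expR_ge1Dx _)).
suff : C <= s n * (r - r') by lra.
rewrite -ler_pdivrMr ?subr_gt0//; near: n; exact: s_ge.
Unshelve. all: by end_near. Qed.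

Lemma chernoff_abs (m l e : R) : 0 <= l -> 0 < e -> \forall n \near \oo,
  fprob (mu n) (fun t => m <= `|W n t|) <=
    2 * expR (- s n * (l * m - l ^+ 2 / 2 * v - e)).
Proof.
move=> l0 e0; near=> n.
have s0 : 0 <= s n by near: n; exact: s_ge.
rewrite -(ler_pM2l (expR_gt0 (l * s n * m))).
apply: (@le_trans _ _ (fexp (mu n) (fun t => expR (l * s n * W n t)
    + expR (- l * s n * W n t)))).
  apply: (fprob_markov (@mu_ge0 n)) => [t|t].
    by rewrite addr_ge0 ?expR_ge0.
  rewrite ler_normr orbC => /orP[h|h].
    apply: (@le_trans _ _ (expR (- l * s n * W n t))).
      by rewrite ler_expR; have := ler_wpM2l (mulr_ge0 l0 s0) h; lra.
    by rewrite lerDr expR_ge0.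
  apply: (@le_trans _ _ (expR (l * s n * W n t))).
    by rewrite ler_expR; have := ler_wpM2l (mulr_ge0 l0 s0) h; lra.
  by rewrite lerDl expR_ge0.
rewrite fexpD mulrCA -expRD.
have -> : l * s n * m + - s n * (l * m - l ^+ 2 / 2 * v - e) =
  s n * (l ^+ 2 / 2 * v + e) by ring.
have h1 : fexp (mu n) (fun t => expR (l * s n * W n t)) <=
    expR (s n * (l ^+ 2 / 2 * v + e)).
  by near: n; apply: filterS (W_laplace l e0) => n /andP[].
have h2 : fexp (mu n) (fun t => expR (- l * s n * W n t)) <=
    expR (s n * (l ^+ 2 / 2 * v + e)).
  by near: n; apply: filterS (W_laplace (- l) e0) => n /andP[_]; rewrite sqrrN.
lra.
Unshelve. all: by end_near. Qed.

Lemma tail_abs (m l r : R) : 0 <= l -> r < l * m - l ^+ 2 / 2 * v ->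
  \forall n \near \oo,
    fprob (mu n) (fun t => m <= `|Z n t|) <= expR (- s n * r).
Proof.
move=> l0 hr.
(* The surplus [g] is spent in quarters: on replacing [Z] by [W], which shifts [m] by [d] with
   [l * d <= e], on the error of the Laplace transform, and on absorbing the factor 3. *)
pose g := l * m - l ^+ 2 / 2 * v - r.
have g0 : 0 < g by rewrite /g subr_gt0.
pose e := g / 4; have e0 : 0 < e by rewrite divr_gt0.
pose d := e / (l + 1); have d0 : 0 < d by rewrite divr_gt0 ?ltr_wpDl.
have ld : l * d <= e.
  by rewrite /d mulrCA ger_pMr// ler_pdivrMr ?ltr_wpDl// mul1r lerDl.
near=> n.
have s0 : 0 <= s n by near: n; exact: s_ge.
apply: (@le_trans _ _ (fprob (mu n) (fun t => m - d <= `|W n t|) +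
    fprob (mu n) (fun t => d <= `|Z n t - W n t|))).
  apply: (fprob_leD (@mu_ge0 n)) => t mZ; case: (leP d) => //=; rewrite ?orbT// orbF => h.
  by have := ler_normD (Z n t - W n t) (W n t); rewrite subrK; lra.
have h1 : fprob (mu n) (fun t => m - d <= `|W n t|) <=
    2 * expR (- s n * (l * (m - d) - l ^+ 2 / 2 * v - e)).
  by near: n; exact: chernoff_abs.
have h2 : fprob (mu n) (fun t => d <= `|Z n t - W n t|) <= expR (- s n * (r + e)).
  by near: n; exact: ZW_equiv.
have h3 : expR (- s n * (l * (m - d) - l ^+ 2 / 2 * v - e)) <= expR (- s n * (r + e)).
  by rewrite ler_expR !mulNr lerN2 ler_wpM2l// mulrBr; move: ld g0; rewrite /e /g; lra.
have h4 : 3 * expR (- s n * (r + e)) <= expR (- s n * r).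
  by near: n; apply: absorb_constant; rewrite ltrDl.
lra.
Unshelve. all: by end_near. Qed.

(** The centre [l * v] is the derivative of [l ^+ 2 / 2 * v], the point at which tilting by [l]
    makes [W n] concentrate. The Laplace transform at [l] is split over the ball and its two sides;
    the sides are negligible, so the ball carries half of it, and on the ball the exponential weight
    is nearly constant. *)
Lemma ball_lower (l d e : R) : 0 < d -> 0 < e -> \forall n \near \oo,
  expR (- s n * (l ^+ 2 / 2 * v + e)) <= fprob (mu n) (fun t => `|Z n t - l * v| < d).
Proof.
move=> d0 e0.
wlog hd : d d0 / `|l| * d <= e / 2.
  move=> wl; pose d' := Num.min d (e / 2 / (`|l| + 1)).
  have p0 : 0 < e / 2 / (`|l| + 1) by rewrite !divr_gt0 ?ltr_wpDl.
  have d'0 : 0 < d' by rewrite lt_min d0.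
  have d'e : d' <= e / 2 / (`|l| + 1) by rewrite ge_min lexx orbT.
  have ld' : `|l| * d' <= e / 2.
    apply: (le_trans (ler_wpM2l (normr_ge0 _) d'e)).
    rewrite mulrCA ger_pMr ?divr_gt0// ler_pdivrMr ?ltr_wpDl//.
    by rewrite mul1r lerDl.
  apply: filterS (wl _ d'0 ld') => n /le_trans; apply.
  apply: (le_fprob (@mu_ge0 n)) => t /lt_le_trans; apply.
  by rewrite ge_min lexx.
pose x := l * v; pose d1 := d / 2.
have d10 : 0 < d1 by rewrite divr_gt0.
(* Tilting further by [k] changes the exponent on a tail by [k ^+ 2 / 2 * v - k * d1], at most
   [- k * d1 / 2] once [k * v <= d1]. The denominator [v + 1] is positive even for [v = 0]. *)
pose k := d1 / (v + 1).
have v10 : 0 < v + 1 by rewrite ltr_wpDl.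
have k0 : 0 < k by rewrite divr_gt0.
have kv : k * v <= d1.
  by rewrite /k -mulrA ger_pMr// ler_pdivrMl// mulr1 lerDl.
pose e1 := Num.min (k * d1 / 8) (e / 8).
have kd0 := mulr_gt0 k0 d10.
have e10 : 0 < e1 by rewrite lt_min (divr_gt0 kd0)// divr_gt0.
have e1k : e1 <= k * d1 / 8 by rewrite ge_min lexx.
have e1e : e1 <= e / 8 by rewrite ge_min lexx orbT.
near=> n.
have s0 : 0 <= s n by near: n; exact: s_ge.
pose B := fun t => `|W n t - x| < d1.
have hB : fprob (mu n) B <= fprob (mu n) (fun t => `|Z n t - x| < d) +
    fprob (mu n) (fun t => d1 <= `|Z n t - W n t|).
  apply: (fprob_leD (@mu_ge0 n)) => t; rewrite /B => WB.
  case: (leP d1); rewrite ?orbT// orbF => h.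
  by have := ler_normD (Z n t - W n t) (W n t - x); rewrite addrA subrK /d1 in WB h *; lra.
have hL : expR (s n * (l ^+ 2 / 2 * v - e1)) <=
    fexp (mu n) (fun t => expR (l * s n * W n t)).
  by near: n; apply: filterS (W_laplace l e10) => n /andP[].
(* Under the law tilted by [expR (l * s n * W n t)] the variable [W n] concentrates at [x]:
   each of the two tails is dominated by tilting by [k] a little further. *)
have hU1 : fexp (mu n) (fun t => expR ((l + k) * s n * W n t)) <=
    expR (s n * ((l + k) ^+ 2 / 2 * v + e1)).
  by near: n; apply: filterS (W_laplace (l + k) e10) => n /andP[].
have hU2 : fexp (mu n) (fun t => expR ((l - k) * s n * W n t)) <=
    expR (s n * ((l - k) ^+ 2 / 2 * v + e1)).
  by near: n; apply: filterS (W_laplace (l - k) e10) => n /andP[].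
have split_exp : fexp (mu n) (fun t => expR (l * s n * W n t)) <=
    expR (s n * (l * x + `|l| * d1)) * fprob (mu n) B +
    (expR (- (k * s n * (x + d1))) * fexp (mu n) (fun t => expR ((l + k) * s n * W n t)) +
     expR (k * s n * (x - d1)) * fexp (mu n) (fun t => expR ((l - k) * s n * W n t))).
  rewrite fprobE -!fexpZ -!fexpD; apply: (le_fexp (@mu_ge0 n)) => t.
  have E1 := expR_ge0 (- (k * s n * (x + d1))).
  have E2 := expR_ge0 (k * s n * (x - d1)).
  have E3 := expR_ge0 ((l + k) * s n * W n t).
  have E4 := expR_ge0 ((l - k) * s n * W n t).
  have [WB|] := boolP (B t).
    rewrite mulr1; apply: (@le_trans _ _ (expR (s n * (l * x + `|l| * d1)))).
      rewrite ler_expR mulrAC mulrC ler_wpM2l//.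
      have -> : l * W n t = l * x + l * (W n t - x) by ring.
      rewrite lerD2l; apply: (le_trans (ler_norm _)).
      by rewrite normrM ler_wpM2l// ltW.
    by rewrite lerDl addr_ge0// mulr_ge0.
  rewrite mulr0 add0r /B -leNgt ler_normr orbC => /orP[h|h].
    apply: (@le_trans _ _ (expR (k * s n * (x - d1)) * expR ((l - k) * s n * W n t))).
      have hW : W n t - x <= - d1 by clear hB hL hU1 hU2 E1 E2 E3 E4; lra.
      by rewrite -expRD ler_expR; have := ler_wpM2l (mulr_ge0 (ltW k0) s0) hW;
        clear hB hL hU1 hU2 E1 E2 E3 E4 h; lra.
    by rewrite lerDr mulr_ge0.
  apply: (@le_trans _ _ (expR (- (k * s n * (x + d1))) * expR ((l + k) * s n * W n t))).
    by rewrite -expRD ler_expR; have := ler_wpM2l (mulr_ge0 (ltW k0) s0) h;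
      clear hB hL hU1 hU2 E1 E2 E3 E4 h; lra.
  by rewrite lerDl mulr_ge0.
pose A := expR (s n * (l ^+ 2 / 2 * v - e1)).
have far : 4 * expR (s n * (l ^+ 2 / 2 * v - k * d1 / 2 + e1)) <= A.
  have h : 4 * expR (- s n * (k * d1 / 8)) <= expR (- s n * 0).
    by near: n; apply: absorb_constant; rewrite divr_gt0.
  have -> : s n * (l ^+ 2 / 2 * v - k * d1 / 2 + e1) =
    s n * (l ^+ 2 / 2 * v - e1) - s n * (k * d1 / 2 - 2 * e1) by ring.
  rewrite expRD mulrCA -/A ger_pMr ?expR_gt0//.
  apply: (@le_trans _ _ (4 * expR (- s n * (k * d1 / 8)))).
    by rewrite ler_pM2l// ler_expR mulNr lerN2 ler_wpM2l//; clear hB hL hU1 hU2 split_exp h; lra.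
  by rewrite mulr0 expR0 in h.
(* The sign [c] treats both tails at once; the cross term [c * k * l * v] of the square cancels
   against [c * k * x]. *)
have Uk (c y : R) : c ^+ 2 = 1 -> y = - (c * k * s n * x) - k * s n * d1 ->
    expR y * expR (s n * ((l + c * k) ^+ 2 / 2 * v + e1)) <= A / 4.
  move=> c1 ->; rewrite ler_pdivlMr// mulrC; apply: le_trans far.
  rewrite ler_pM2l// -expRD ler_expR.
  have -> : - (c * k * s n * x) - k * s n * d1 + s n * ((l + c * k) ^+ 2 / 2 * v + e1) =
    s n * (l ^+ 2 / 2 * v + c ^+ 2 * k ^+ 2 / 2 * v - k * d1 + e1).
    by rewrite /x; field.
  by rewrite c1 mul1r ler_wpM2l//; have := ler_wpM2l (ltW k0) kv;
    clear hB hL hU1 hU2 split_exp; lra.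
have far1 := Uk 1 (- (k * s n * (x + d1))) (expr1n _ _) ltac:(ring).
have far2 := Uk (-1) (k * s n * (x - d1)) (sqrr_sign _ 1) ltac:(ring).
rewrite mul1r in far1; rewrite mulN1r in far2.
have m1 := ler_wpM2l (expR_ge0 (- (k * s n * (x + d1)))) hU1.
have m2 := ler_wpM2l (expR_ge0 (k * s n * (x - d1))) hU2.
have PB : A / 2 <= expR (s n * (l * x + `|l| * d1)) * fprob (mu n) B.
  by rewrite -/A in hL; clear hB hU1 hU2 far Uk; lra.
have PB' : expR (- s n * (l ^+ 2 / 2 * v + `|l| * d1 + e1)) / 2 <= fprob (mu n) B.
  rewrite -(ler_pM2l (expR_gt0 (s n * (l * x + `|l| * d1)))).
  apply: le_trans PB; rewrite mulrA -expRD ler_pM2r ?invr_gt0//.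
  rewrite /A ler_expR /x.
  by rewrite le_eqVlt; apply/orP; left; apply/eqP; field.
have PZ : fprob (mu n) (fun t => d1 <= `|Z n t - W n t|) <=
    expR (- s n * (l ^+ 2 / 2 * v + e)).
  by near: n; exact: ZW_equiv.
have fin : 4 * expR (- s n * (l ^+ 2 / 2 * v + e)) <=
    expR (- s n * (l ^+ 2 / 2 * v + `|l| * d1 + e1)).
  apply: (@le_trans _ _ (expR (- s n * (l ^+ 2 / 2 * v + 3 / 4 * e)))).
    by near: n; apply: absorb_constant; lra.
  by rewrite ler_expR !mulNr lerN2 ler_wpM2l// /d1;
    clear hB hL hU1 hU2 split_exp far Uk far1 far2 m1 m2 PB PB' PZ; lra.
by clear hL hU1 hU2 split_exp far Uk far1 far2 m1 m2 PB; lra.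
Unshelve. all: by end_near. Qed.

(** Since the rate grows with [|x|], a set on which it exceeds a level lies outside an interval
    around 0. One two-sided tail bound therefore gives the upper bound, with no covering argument or
    exponential tightness. For the lower bound, a ball around an interior point of finite rate
    suffices. *)
Lemma gartner_ellis_gaussian (law : nat -> set R -> \bar R) :
  (forall n G, measurable G -> law n G = (fprob (mu n) (fun t => `[< G (Z n t) >]))%:E) ->
  moderate_deviation_principle law s (gaussian_rate v).
Proof.
move=> lawE; split=> //; first exact: good_rate_gaussian.
move=> G mG; split; last 1 first.
- apply: le_oppe_real => r hr.
  have [r0|r0] := ltP r 0.
    apply: limn_esup_le_near; near=> n.
    have s0 : 0 <= s n by near: n; exact: s_ge.
    apply: (@le_trans _ _ 0%E); last by rewrite lee_fin oppr_ge0 ltW.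
    rewrite mule_ge0_le0 ?lee_fin ?invr_ge0// lne_le0 lawE// lee_fin -(@mu_sum1 n).
    by rewrite /fprob big_mkcond ler_sum// => t _; case: ifP.
  have far x : closure G x -> 2 * v * r < x ^+ 2.
    move=> Gx; rewrite ltNge; apply/negP => /(gaussian_rate_leP _ v_ge0 r0).
    rewrite leNgt => /negP; apply; apply: (lt_le_trans hr).
    by apply: ereal_inf_lbound; exists x.
  apply/lee_addgt0Pr => e e0.
  (* For [v = 0] the point 0 is not in the closure of [G]: [m] is the radius of a ball missing [G],
     and [l] is as large as required. Otherwise [m] is the end of the level set at [r] and
     [l = m / v] is the optimal slope. *)
  have [m [l [l0 lr Gm]]] : exists m l : R, [/\ 0 <= l,
      r - e < l * m - l ^+ 2 / 2 * v & forall x, G x -> m <= `|x|].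
    have [v_eq0|vn0] := eqVneq v 0.
      have : ~ closure G 0 by move=> /far; rewrite v_eq0 mulr0 mul0r expr0n ltxx.
      rewrite /closure /= => /existsNP[B /not_implyP[nB /nonemptyPn GB]].
      have [d /= d0 dB] := nB.
      exists d, ((r + 1) / d); split.
      + by rewrite divr_ge0 ?addr_ge0// ltW.
      + by rewrite v_eq0 mulr0 subr0 divfK ?gt_eqF// ltrBlDr -addrA ltrDl addr_gt0.
      + move=> x Gx; rewrite leNgt; apply/negP => xd.
        suff : (G `&` B) x by rewrite GB.
        by split => //; apply: dB; rewrite /ball_ /= sub0r normrN.
    have vp : 0 < v by rewrite lt0r vn0.
    have q0 : 0 <= 2 * v * r by rewrite !mulr_ge0.
    exists (Num.sqrt (2 * v * r)), (Num.sqrt (2 * v * r) / v); split.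
    + by rewrite divr_ge0 ?sqrtr_ge0.
    + set q := Num.sqrt _.
      have -> : q / v * q - (q / v) ^+ 2 / 2 * v = q ^+ 2 / (2 * v) by field.
      by rewrite sqr_sqrtr// mulrAC divff ?mulf_neq0 ?pnatr_eq0// mul1r gtrBl.
    + by move=> x /subset_closure /far /ltW; rewrite -sqrtr_sqr => h; exact: ler_wsqrtr.
  rewrite -EFinD; apply: limn_esup_le_near; near=> n.
  have s0 : 0 < s n by apply: (@lt_le_trans _ _ 1) => //; near: n; exact: s_ge.
  have h : fprob (mu n) (fun t => `[< G (Z n t) >]) <= expR (- s n * (r - e)).
    apply: (@le_trans _ _ (fprob (mu n) (fun t => m <= `|Z n t|))).
      by apply: (le_fprob (@mu_ge0 n)) => t /asboolP/Gm.
    by near: n; exact: tail_abs l0 lr.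
  rewrite lawE//.
  have [p0|p0] := leP (fprob (mu n) (fun t => `[< G (Z n t) >])) 0.
    by rewrite le0_lneNy ?lee_fin// gt0_muleNy ?lte_fin ?invr_gt0// leNye.
  rewrite lne_EFin// -EFinM lee_fin ler_pdivrMl//.
  rewrite -ler_expR lnK ?posrE//; apply: (le_trans h).
  by rewrite ler_expR mulNr -mulrN opprB addrC.
- rewrite leeNl; apply: le_ereal_inf_tmp => _ [x Gx <-].
  rewrite leeNl.
  case Ix : (gaussian_rate v x) => [i| |]; last 2 first.
  + by rewrite leNye.
  + have : (0 <= gaussian_rate v x)%E.
      by apply: ereal_sup_ubound; exists 0 => //; rewrite mul0r expr0n !mul0r subrr.
    by rewrite Ix.
  have i0 : 0 <= i.
    rewrite -lee_fin -Ix; apply: ereal_sup_ubound; exists 0 => //.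
    by rewrite mul0r expr0n !mul0r subrr.
  have [l xl] : exists l, x = l * v.
    have [v_eq0|vn0] := eqVneq v 0; last by exists (x / v); rewrite divfK.
    exists 0; rewrite mul0r; apply/eqP; rewrite -sqrf_eq0 eq_le sqr_ge0 andbT.
    have /(gaussian_rate_leP _ v_ge0 i0) : (gaussian_rate v x <= i%:E)%E by rewrite Ix.
    by rewrite v_eq0 mulr0 mul0r.
  have li : l ^+ 2 / 2 * v <= i.
    rewrite -lee_fin -Ix; apply: ereal_sup_ubound; exists l => //.
    by congr EFin; rewrite xl; field.
  have [d /= d0 dG] : \forall y \near x, G y by exact: Gx.
  apply/lee_subgt0Pr => e e0; rewrite -EFinN -EFinB.
  apply: limn_einf_ge_near; near=> n.
  have s0 : 0 < s n by apply: (@lt_le_trans _ _ 1) => //; near: n; exact: s_ge.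
  have h : expR (- s n * (l ^+ 2 / 2 * v + e)) <=
      fprob (mu n) (fun t => `[< G (Z n t) >]).
    apply: (@le_trans _ _ (fprob (mu n) (fun t => `|Z n t - l * v| < d))).
      by near: n; exact: ball_lower.
    apply: (le_fprob (@mu_ge0 n)) => t h; apply/asboolP/dG.
    by rewrite /ball_ /= distrC xl.
  rewrite lawE// lne_EFin; last by rewrite (lt_le_trans _ h)// expR_gt0.
  rewrite -EFinM lee_fin ler_pdivlMl//.
  rewrite -ler_expR lnK ?posrE ?(lt_le_trans (expR_gt0 _) h)//; apply: le_trans h.
  by rewrite ler_expR mulNr -mulrN ler_wpM2l ?(ltW s0)// opprD lerD2r lerN2.
- exact: limn_einf_sup.
Unshelve. all: by end_near. Qed.

End GartnerEllis.

(** * Elementary bounds on the exponential *)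

Section ExpBounds.
Context (R : realType).
Implicit Types u x : R.

(** From degree 3 on, each term of the exponential series at [u] is at most [|u| ^+ 3] times the
    same term at 1; the terms at 1 sum to at most [expR 1]. *)
Lemma expR_taylor2 u : `|u| <= 1 ->
  `|expR u - (1 + u + u ^+ 2 / 2)| <= expR 1 * `|u| ^+ 3.
Proof.
move=> u1; pose c := 1 + u + u ^+ 2 / 2.
have le_term n : `|series (exp_coeff u) n.+3 - c| <= series (exp_coeff 1) n.+3 * `|u| ^+ 3.
  have E w : series (exp_coeff w) n.+3 =
      1 + w + w ^+ 2 / 2 + \sum_(0 <= k < n) exp_coeff w k.+3.
    rewrite /series /= !big_nat_recl// /exp_coeff /= expr0 expr1.
    by rewrite (_ : 0`! = 1)%N// (_ : 1`! = 1)%N// (_ : 2`! = 2)%N// !divr1 !addrA.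
  rewrite !E addrAC subrr add0r mulrDl.
  apply: (@le_trans _ _ ((\sum_(0 <= k < n) exp_coeff 1 k.+3) * `|u| ^+ 3)).
    apply: (le_trans (ler_norm_sum _ _ _)); rewrite mulr_suml.
    apply: ler_sum => k _; rewrite /exp_coeff /= expr1n normrM normrX.
    rewrite (ger0_norm (x := _^-1)) ?invr_ge0// mulrC mul1r ler_wpM2l ?invr_ge0//.
    by apply: ler_wiXn2l.
  by rewrite lerDr mulr_ge0 ?exprn_ge0// expr1n !addr_ge0.
have cv := is_cvg_series_exp_coeff u.
have cv1 := is_cvg_series_exp_coeff (1 : R).
have lim_u : (fun n => `|series (exp_coeff u) n - c|) @ \oo --> `|expR u - c|.
  by apply: cvg_norm; apply: cvgB => //; exact: cvg_cst.
have lim_1 : (fun n => series (exp_coeff 1) n * `|u| ^+ 3) @ \oo --> expR 1 * `|u| ^+ 3.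
  by apply: cvgMr_tmp => //.
apply: (ler_cvg_to lim_u lim_1).
by exists 3%N => // -[|[|[|n]]] //= _; exact: le_term.
Qed.

Lemma expr4_le_expR x : x ^+ 4 <= 24 * (expR x + expR (- x)).
Proof.
wlog x0 : x / 0 <= x.
  move=> wl; have [/wl//|/ltW xle0] := leP 0 x.
  have := wl (- x); rewrite oppr_ge0 opprK (_ : (- x) ^+ 4 = x ^+ 4); last by ring.
  by rewrite addrC; exact.
have := expR_ge1Dxn 3 x0; have := expR_ge0 (- x).
have -> : 4`!%:R = 24 :> R by [].
lra.
Qed.

End ExpBounds.

(** * Poisson's equation *)

Section Poisson.
Context (R : realType) (S : finType) (p : S -> S -> R) (pi : S -> R).
Hypothesis p_stoch : stochastic p.
Hypothesis p_irr : irreducible_chain p.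
Hypothesis pi_sum1 : \sum_x pi x = 1.
Hypothesis pi_inv : forall y, \sum_x pi x * p x y = pi y.

Definition transition (p' : S -> S -> R) (f : S -> R) (x : S) : R := \sum_y p' x y * f y.

Lemma transition_cst c x : transition p (fun=> c) x = c.
Proof. by rewrite /transition -mulr_suml p_stoch.2 mul1r. Qed.

Lemma sum_pi_transition f : \sum_x pi x * transition p f x = \sum_x pi x * f x.
Proof.
under eq_bigr do rewrite mulr_sumr; rewrite exchange_big; apply: eq_bigr => y _.
by rewrite -pi_inv mulr_suml; apply: eq_bigr => x _; rewrite mulrA.
Qed.

Lemma nstep_stochastic n : stochastic (nstep p n).
Proof.
have [p0 p1] := p_stoch.
elim: n => [|n [IH0 IH1]]; split=> [x y|x] /=.
- exact: ler0n.
- by rewrite (bigD1 x)//= eqxx big1 ?addr0// => y /negPf; rewrite eq_sym => ->.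
- by apply: sumr_ge0 => z _; rewrite mulr_ge0.
- rewrite exchange_big -[RHS](p1 x); apply: eq_bigr => z _.
  by rewrite -mulr_sumr IH1 mulr1.
Qed.

Lemma nstep_harmonic f n x : transition p f =1 f -> transition (nstep p n) f x = f x.
Proof.
move=> hf; elim: n x => [|n IH] x; rewrite /transition /=.
  rewrite (bigD1 x)//= eqxx mul1r big1 ?addr0// => y /negPf; rewrite eq_sym => ->.
  by rewrite mul0r.
under eq_bigr do rewrite mulr_suml.
rewrite exchange_big -[RHS]hf; apply: eq_bigr => z _.
by rewrite -IH mulr_sumr; apply: eq_bigr => y _; rewrite mulrA.
Qed.

(* At a maximum of [f] the mean of [f] over [p^n(x, -)] is [f x], so [f] is maximal
   at every point reachable from [x]. *)
Lemma harmonic_constant f x y : transition p f =1 f -> f x = f y.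
Proof.
move=> hf; pose z := [arg max_(z > x) f z]%O.
have zmax u : f u <= f z by rewrite /z; case: arg_maxP => // i _; exact.
suff const u : f u = f z by rewrite !const.
have [n pn] := p_irr z u; have [n0 n1] := nstep_stochastic n.
have : \sum_w nstep p n z w * (f z - f w) = 0.
  under eq_bigr do rewrite mulrBr.
  by rewrite sumrB -mulr_suml n1 mul1r -[X in X - _](nstep_harmonic n z hf) subrr.
move/eqP; rewrite psumr_eq0 => [/allP/(_ u)|w _]; last by rewrite mulr_ge0 ?subr_ge0.
by rewrite mem_index_enum mulf_eq0 gt_eqF//= subr_eq0 => /(_ isT)/eqP.
Qed.

(** A dimension count. The kernel of [id - p] consists of constants by [harmonic_constant], so it
    has dimension at most 1. The range lies in the kernel of the functional [pi] by invariance, and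
    that kernel is a hyperplane because [pi] takes the value 1 on the constant 1. By rank and
    nullity the two coincide. *)
Lemma poisson_equation (f : S -> R) : \sum_x pi x * f x = 0 ->
  exists g : S -> R, forall x, g x - transition p g x = f x.
Proof.
move=> pf0.
pose V := ({ffun S -> R^o} : vectType R).
pose A0 (g : V) : V := [ffun x => g x - transition p g x].
have A0_lin : linear A0.
  move=> a u w; apply/ffunP => x; rewrite !ffunE.
  have -> : transition p (a *: u + w) x = a * transition p u x + transition p w x.
    rewrite /transition mulr_sumr -big_split; apply: eq_bigr => y _ /=.
    by rewrite !ffunE mulrDr mulrCA.
  by rewrite /GRing.scale/= mulrBr opprD addrACA.
pose l0 (g : V) : R^o := \sum_x pi x * g x.
have l0_lin : linear l0.
  move=> a u w; rewrite /l0 /GRing.scale/= mulr_sumr -big_split; apply: eq_bigr => y _ /=.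
  by rewrite !ffunE mulrDr mulrCA.
pose A1 := GRing.isLinear.Build R V V *:%R A0 A0_lin.
pose A2 : {linear V -> V} := HB.pack A0 A1.
pose l1 := GRing.isLinear.Build R V R^o *:%R l0 l0_lin.
pose l2 : {linear V -> R^o} := HB.pack l0 l1.
pose A := linfun A2; pose l := linfun l2.
pose one : V := [ffun=> 1].
have kerA : (lker A <= <[one]>)%VS.
  apply/subvP => g; rewrite memv_ker lfunE /= => /eqP/ffunP hg.
  have hg' : transition p g =1 g.
    by move=> x; have := hg x; rewrite !ffunE => /eqP; rewrite subr_eq0 => /eqP.
  have [x _|S0] := pickP (fun _ : S => true).
    apply/vlineP; exists (g x); apply/ffunP => y; rewrite !ffunE /GRing.scale/= mulr1.
    exact: harmonic_constant.
  have -> : g = 0 by apply/ffunP => x; have := S0 x.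
  exact: mem0v.
have imA : (limg A <= lker l)%VS.
  apply/subvP => _ /memv_imgP[g _ ->]; rewrite memv_ker !lfunE /= /l0.
  under eq_bigr do rewrite ffunE mulrBr.
  by rewrite sumrB sum_pi_transition subrr.
have iml : (0 < \dim (limg l))%N.
  rewrite lt0n dimv_eq0; apply/eqP => im0.
  have : l one \in limg l by apply: memv_img; exact: memvf.
  rewrite im0 memv0 lfunE /= /l0; under eq_bigr do rewrite ffunE mulr1.
  by rewrite pi_sum1 oner_eq0.
have dA := limg_ker_dim A fullv; have dl := limg_ker_dim l fullv.
rewrite !capfv in dA dl.
have dk : (\dim (lker A) <= 1)%N.
  by apply: (leq_trans (dimvS kerA)); rewrite dim_vline leq_b1.
have /eqP imE : limg A == lker l.
  rewrite eqEdim imA/= -(leq_add2l (\dim (lker A))) dA -dl addnC.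
  by rewrite leq_add2l (leq_trans dk).
have : [ffun x => f x] \in lker l.
  rewrite memv_ker lfunE /= /l0; under eq_bigr do rewrite ffunE.
  by rewrite pf0.
rewrite -imE => /memv_imgP[g _]; rewrite lfunE /= => /ffunP hg.
by exists g => x; have := hg x; rewrite !ffunE => <-.
Qed.

End Poisson.

(** * Laplace transforms of additive functionals *)

Section PathExpectation.
Context (R : realType) (S : finType) (p : S -> S -> R) (pi : S -> R).
Hypothesis p_stoch : stochastic p.
Hypothesis pi_ge0 : forall x, 0 <= pi x.
Hypothesis pi_sum1 : \sum_x pi x = 1.
Hypothesis pi_inv : forall y, \sum_x pi x * p x y = pi y.
Context (x0 : S).

Fixpoint traj_weight (q : S -> S -> R) (x : S) (s : seq S) : R :=
  if s is y :: s' then q x y * traj_weight q y s' else 1.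

Definition path_weight (q : S -> S -> R) (m : S -> R) (s : seq S) : R :=
  if s is x :: s' then m x * traj_weight q x s' else 1.

Lemma traj_weight_rcons q x s y :
  traj_weight q x (rcons s y) = traj_weight q x s * q (last x s) y.
Proof.
by elim: s x => [|z s IH] x /=; rewrite ?mulr1 ?mul1r// IH mulrA.
Qed.

Lemma path_weight_rcons q m s y : (0 < size s)%N ->
  path_weight q m (rcons s y) = path_weight q m s * q (last x0 s) y.
Proof. by case: s => //= x s _; rewrite traj_weight_rcons mulrA. Qed.

Lemma traj_weight_ge0 x s : 0 <= traj_weight p x s.
Proof. by elim: s x => //= y s IH x; rewrite mulr_ge0// p_stoch.1. Qed.

Lemma path_weight_ge0 s : 0 <= path_weight p pi s.
Proof. by case: s => //= x s; rewrite mulr_ge0// traj_weight_ge0. Qed.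

Lemma sum_tuple_rcons n (G : seq S -> R) :
  \sum_(t : n.+1.-tuple S) G t = \sum_(t : n.-tuple S) \sum_y G (rcons t y).
Proof.
rewrite pair_big (reindex (fun u : n.-tuple S * S => [tuple of rcons u.1 u.2]))//=.
exists (fun t : n.+1.-tuple S =>
  ([tuple of belast (head x0 t) (behead t)], last x0 t)) => [[t y] _|t _].
  congr (_, _); last by rewrite /= last_rcons.
  by apply: val_inj => /=; case: (val t) => //= x s; rewrite belast_rcons.
by apply: val_inj => /=; case: t => -[|x s] //= _; rewrite -lastI.
Qed.

Definition path_exp n (F : seq S -> R) : R :=
  fexp (fun t : n.-tuple S => path_weight p pi t) (fun t => F t).

Lemma path_exp1 F : path_exp 1 F = \sum_x pi x * F [:: x].
Proof.
rewrite /path_exp /fexp (sum_tuple_rcons _ (fun s => path_weight p pi s * F s)).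
rewrite (big_pred1 [tuple]); last by case=> -[]//= ?; apply/esym/eqP/val_inj.
by apply: eq_bigr => x _ /=; rewrite mulr1.
Qed.

(** The Markov property: the last state is averaged given all earlier ones. Every induction on the
    length of the path rests on it, which is why paths grow at their right end. *)
Lemma path_expS n F : path_exp n.+2 F =
  path_exp n.+1 (fun s => transition p (fun y => F (rcons s y)) (last x0 s)).
Proof.
rewrite /path_exp /fexp (sum_tuple_rcons _ (fun s => path_weight p pi s * F s)).
apply: eq_bigr => t _; rewrite mulr_sumr; apply: eq_bigr => y _.
by rewrite path_weight_rcons ?size_tuple// mulrA.
Qed.

Lemma path_weight_sum1 n : \sum_(t : n.-tuple S) path_weight p pi t = 1.
Proof.
case: n => [|n].
  by rewrite (big_pred1 [tuple])//; case=> -[]//= ?; apply/esym/eqP/val_inj.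
rewrite -[LHS]mul1r -(@fexp_cst _ _ (fun t : n.+1.-tuple S => path_weight p pi t)).
elim: n => [|n IH]; first by rewrite -[LHS]/(path_exp 1 (fun=> 1)) path_exp1;
  under eq_bigr do rewrite mulr1.
rewrite -[LHS]/(path_exp n.+2 (fun=> 1)) path_expS -[RHS]IH.
by apply: eq_bigr => t _; rewrite (transition_cst p_stoch).
Qed.

Lemma le_path_exp n F G : (forall s, F s <= G s) -> path_exp n F <= path_exp n G.
Proof. by move=> h; apply: le_fexp => t; rewrite ?path_weight_ge0. Qed.

Lemma eq_path_exp n F G : F =1 G -> path_exp n F = path_exp n G.
Proof. by move=> h; apply: eq_bigr => t _; rewrite h. Qed.

Lemma path_exp_ge0 n F : (forall s, 0 <= F s) -> 0 <= path_exp n F.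
Proof. by move=> h; apply: fexp_ge0 => // t; rewrite path_weight_ge0. Qed.

Lemma path_expD n F G : path_exp n (fun s => F s + G s) = path_exp n F + path_exp n G.
Proof. exact: fexpD. Qed.

Lemma path_expZ n c F : path_exp n (fun s => c * F s) = c * path_exp n F.
Proof. exact: fexpZ. Qed.

Lemma path_expN n F : path_exp n (fun s => - F s) = - path_exp n F.
Proof. by rewrite -mulN1r -path_expZ; apply: eq_path_exp => s; rewrite mulN1r. Qed.

Lemma path_exp_cst n c : path_exp n (fun=> c) = c.
Proof. by rewrite /path_exp fexp_cst path_weight_sum1 mulr1. Qed.

Lemma path_exp_last n f : path_exp n.+1 (fun s => f (last x0 s)) = \sum_x pi x * f x.
Proof.
elim: n f => [|n IH] f; first exact: path_exp1.
rewrite path_expS -(sum_pi_transition pi_inv) -IH; apply: eq_path_exp => s.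
by apply: eq_bigr => y _; rewrite last_rcons.
Qed.

Definition path_sum (f : S -> R) (s : seq S) : R := \sum_(x <- s) f x.

Lemma path_sum_rcons f s y : path_sum f (rcons s y) = path_sum f s + f y.
Proof. by rewrite /path_sum -cats1 big_cat big_seq1. Qed.

Section MartingaleApproximation.
Context (f g : S -> R).
Hypothesis gf : forall x, g x - transition p g x = f x.

Definition cond_var (q : S -> S -> R) (u : S -> R) (x : S) : R :=
  transition q (fun y => (u y - transition q u x) ^+ 2) x.

(** For [u] a solution of Poisson's equation for [f], this is the variance in the central limit
    theorem for [path_sum f]. *)
Definition asymptotic_variance (q : S -> S -> R) (m u : S -> R) : R :=
  \sum_x m x * cond_var q u x.

Let v := asymptotic_variance p pi g.
Let M s := path_sum f s + transition p g (last x0 s).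

Lemma asymptotic_variance_ge0 : 0 <= v.
Proof.
apply: sumr_ge0 => x _; rewrite mulr_ge0//; apply: sumr_ge0 => y _.
by rewrite mulr_ge0 ?sqr_ge0// p_stoch.1.
Qed.

Let fE x : f x + transition p g x = g x.
Proof. by rewrite -gf subrK. Qed.

Let M_rcons s y : M (rcons s y) = M s + (g y - transition p g (last x0 s)).
Proof. by rewrite /M path_sum_rcons last_rcons -addrA fE; ring. Qed.

Lemma increment_mean x : transition p (fun y => g y - transition p g x) x = 0.
Proof.
rewrite /transition; under eq_bigr do rewrite mulrBr.
by rewrite sumrB -mulr_suml p_stoch.2 mul1r subrr.
Qed.

Lemma transitionD u w x : transition p (fun y => u y + w y) x = transition p u x + transition p w x.
Proof. by rewrite -big_split; apply: eq_bigr => y _; rewrite mulrDr. Qed.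

Lemma transitionZ c u x : transition p (fun y => c * u y) x = c * transition p u x.
Proof. by rewrite mulr_sumr; apply: eq_bigr => y _; rewrite mulrCA. Qed.

Lemma eq_transition u w x : u =1 w -> transition p u x = transition p w x.
Proof. by move=> h; apply: eq_bigr => y _; rewrite h. Qed.

(** Martingale increments are orthogonal, and by stationarity each has variance [v]. A path of
    [n.+1] states has only [n] increments; the other term is the second moment on a single state,
    where [M] equals [g]. *)
Lemma path_exp_martingale_sqr n :
  path_exp n.+1 (fun s => M s ^+ 2) = \sum_x pi x * g x ^+ 2 + n%:R * v.
Proof.
elim: n => [|n IH].
  rewrite path_exp1 mul0r addr0; apply: eq_bigr => x _.
  by rewrite /M /path_sum big_seq1 fE.
rewrite path_expS -natr1 mulrDl mul1r addrA -IH -[v](path_exp_last n (cond_var p g)) -path_expD.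
apply: eq_path_exp => s.
rewrite (@eq_transition _ (fun y => (M s ^+ 2 + 2 * M s * (g y - transition p g (last x0 s)))
  + (g y - transition p g (last x0 s)) ^+ 2)); last by move=> y; rewrite M_rcons; ring.
by rewrite !transitionD transitionZ (transition_cst p_stoch) increment_mean mulr0 addr0.
Qed.

End MartingaleApproximation.

Lemma fin_bound (u : S -> R) : exists2 D, 0 <= D & forall x, `|u x| <= D.
Proof.
exists (\sum_x `|u x|) => [|x]; first exact: sumr_ge0.
by rewrite (bigD1 x)//= lerDl sumr_ge0.
Qed.

Lemma fin_bound2 (u : S -> S -> R) : exists2 D, 0 <= D & forall x y, `|u x y| <= D.
Proof.
exists (\sum_x \sum_y `|u x y|) => [|x y].
  by apply: sumr_ge0 => x _; apply: sumr_ge0.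
rewrite (bigD1 x)//= (bigD1 y)//= -addrA lerDl addr_ge0 ?sumr_ge0// => i _.
exact: sumr_ge0.
Qed.

Section LaplaceBounds.
Context (f g k : S -> R).
Hypothesis gf : forall x, g x - transition p g x = f x.
Let v := asymptotic_variance p pi g.
Hypothesis kE : forall x, k x - transition p k x = (cond_var p g x - v) / 2.

(* [expR (t * f) * tilt t] is mapped by the chain to [expR (t ^+ 2 / 2 * v) * tilt t] up to a
   factor [1 + O(t ^+ 3)]: the tilted kernel has, to this order, the positive eigenvector
   [tilt t]; its coefficients [transition p g] and [k] are dictated by the expansion in [t]. *)
Definition tilt (t : R) (x : S) : R := expR (t * transition p g x + t ^+ 2 * k x).

(** [t * alpha x y + t ^+ 2 * beta x y] is the exponent left for a step from [x] to [y] after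
    division by [expR (t ^+ 2 / 2 * v) * tilt t x]; the term in [t] simplifies through
    [f y + transition p g y = g y]. *)
Let alpha x y := g y - transition p g x.
Let beta x y := k y - k x - v / 2.

(** The equation for [k] is made for this: it gives [beta] the conditional mean
    [- cond_var p g x / 2]. As [alpha] has conditional mean 0, the tilted step is then 1 up to order
    3 in [t]. *)
Lemma second_order_cancel x : transition p (fun y => beta x y + alpha x y ^+ 2 / 2) x = 0.
Proof.
rewrite (@eq_transition _ (fun y => k y + (- k x - v / 2) + 2^-1 * alpha x y ^+ 2)); last first.
  by move=> y; rewrite /beta; ring.
rewrite !transitionD transitionZ !(transition_cst p_stoch) -/(cond_var p g x).
by rewrite -[transition p _ x](subKr (k x)) kE; field.
Qed.

(** [expR 1] comes from the Taylor remainder at [u = t * a + t ^+ 2 * b], and 2 bounds the terms of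
    order 3 and 4 in [u ^+ 2 / 2]. *)
Lemma tilted_increment_taylor (D t a b : R) : 1 <= D -> `|a| + `|b| <= D ->
  `|t| * D <= 1 ->
  `|expR (t * a + t ^+ 2 * b) - (1 + t * a + t ^+ 2 * (b + a ^+ 2 / 2))|
    <= (expR 1 + 2) * D ^+ 3 * `|t| ^+ 3.
Proof.
move=> D1 abD tD.
have t1 : `|t| <= 1 by apply: le_trans tD; rewrite ler_peMr.
have aD : `|a| <= D by apply: le_trans abD; rewrite lerDl.
have bD : `|b| <= D by apply: le_trans abD; rewrite lerDr.
have D0 : 0 <= D by apply: le_trans D1.
have uD : `|t * a + t ^+ 2 * b| <= `|t| * D.
  apply: (le_trans (ler_normD _ _)); rewrite (normrM t) (normrM (t ^+ 2)) normrX.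
  apply: (@le_trans _ _ (`|t| * (`|a| + `|b|))); last exact: ler_wpM2l.
  by rewrite mulrDr lerD2l ler_wpM2r// expr2 ler_piMr.
have := expR_taylor2 (le_trans uD tD).
set u := t * a + t ^+ 2 * b => h.
have -> : expR u - (1 + t * a + t ^+ 2 * (b + a ^+ 2 / 2)) =
    (expR u - (1 + u + u ^+ 2 / 2)) + t ^+ 3 * (a * b + t * b ^+ 2 / 2).
  by rewrite /u; field.
apply: (le_trans (ler_normD _ _)).
have -> : (expR 1 + 2) * D ^+ 3 * `|t| ^+ 3 =
  expR 1 * (`|t| * D) ^+ 3 + `|t| ^+ 3 * (2 * D ^+ 3) by ring.
apply: lerD.
  apply: (le_trans h); rewrite ler_wpM2l ?expR_ge0//.
  by rewrite lerXn2r ?nnegrE ?mulr_ge0.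
rewrite normrM normrX ler_wpM2l ?exprn_ge0//.
apply: (le_trans (ler_normD _ _)).
rewrite (normrM a) (normrM (t * _)) (normrM t) normrX (ger0_norm (x := 2^-1))//.
have DD : D ^+ 2 <= D ^+ 3 by exact: ler_weXn2l.
have ab : `|a| * `|b| <= D ^+ 2 by rewrite expr2 ler_pM.
have bb : `|t| * `|b| ^+ 2 <= D ^+ 2.
  by rewrite -[leRHS]mul1r ler_pM ?exprn_ge0// lerXn2r ?nnegrE.
have := exprn_ge0 2 D0; lra.
Qed.

(** Puts the relative error of one step into an exponent, so that over [n] steps the errors add
    up. *)
Lemma expR_near1 (y z : R) : `|y - 1| <= z -> z <= 2^-1 ->
  expR (- (2 * z)) <= y <= expR (2 * z).
Proof.
move=> yz z2; have z0 : 0 <= z by apply: le_trans yz.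
move: yz; rewrite ler_distl => /andP[y1 y2]; apply/andP; split.
  apply: le_trans y1; rewrite expRN -[leLHS]mul1r ler_pdivrMr ?expR_gt0//.
  apply: (@le_trans _ _ ((1 - z) * (1 + 2 * z))); first by nra.
  by rewrite ler_wpM2l ?expR_ge1Dx//; lra.
by apply: (le_trans y2); apply: le_trans (expR_ge1Dx _); lra.
Qed.

Lemma tilt_step : exists K t0 : R, [/\ 0 <= K, 0 < t0, t0 <= 1 &
  forall t : R, `|t| <= t0 -> forall x,
    expR (t ^+ 2 / 2 * v - K * `|t| ^+ 3) * tilt t x
      <= transition p (fun y => expR (t * f y) * tilt t y) x
      <= expR (t ^+ 2 / 2 * v + K * `|t| ^+ 3) * tilt t x].
Proof.
have [Da Da0 hDa] := fin_bound2 alpha; have [Db Db0 hDb] := fin_bound2 beta.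
pose D := 1 + Da + Db; have D1 : 1 <= D by rewrite /D -addrA lerDl addr_ge0.
have D0 : 0 <= D by apply: le_trans D1.
pose K := (expR 1 + 2) * D ^+ 3.
have K0 : 0 <= K by rewrite mulr_ge0 ?exprn_ge0// addr_ge0 ?expR_ge0.
have K1 : 0 < D + 2 * K by rewrite ltr_wpDr ?mulr_ge0// (lt_le_trans _ D1).
(* The threshold secures [|t| * D <= 1] for the Taylor bound and [K * |t| ^+ 3 <= 2^-1] for
   [expR_near1], which doubles [K]. *)
exists (2 * K), (D + 2 * K)^-1; split.
- by rewrite mulr_ge0.
- by rewrite invr_gt0.
- by rewrite invf_le1//; have := mulr_ge0 (ler0n R 2) K0; lra.
move=> t ht x.
have tDK : `|t| * (D + 2 * K) <= 1 by rewrite -ler_pdivlMr// div1r.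
have tD : `|t| * D <= 1.
  by apply: le_trans tDK; rewrite ler_wpM2l// lerDl mulr_ge0.
have t1 : `|t| <= 1 by apply: le_trans tD; rewrite ler_peMr.
have tK : K * `|t| ^+ 3 <= 2^-1.
  apply: (@le_trans _ _ (K * `|t|)).
    by rewrite ler_wpM2l// -[leRHS]expr1 ler_wiXn2l.
  have : `|t| * (2 * K) <= 1.
    by apply: le_trans tDK; rewrite ler_wpM2l// lerDr.
  lra.
pose u y := t * alpha x y + t ^+ 2 * beta x y.
have -> : transition p (fun y => expR (t * f y) * tilt t y) x =
    transition p (fun y => expR (u y)) x * (expR (t ^+ 2 / 2 * v) * tilt t x).
  rewrite mulrC -transitionZ; apply: eq_transition => y.
  rewrite /tilt -!expRD; congr expR.
  by rewrite -gf /u /alpha /beta; field.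
have near1 : `|transition p (fun y => expR (u y)) x - 1| <= K * `|t| ^+ 3.
  pose main y := 1 + t * alpha x y + t ^+ 2 * (beta x y + alpha x y ^+ 2 / 2).
  have main1 : transition p main x = 1.
    rewrite /main !transitionD !transitionZ (transition_cst p_stoch) second_order_cancel.
    by rewrite increment_mean !mulr0 !addr0.
  rewrite -main1 -mulN1r -transitionZ -transitionD.
  rewrite -[leRHS](transition_cst p_stoch _ x).
  apply: (le_trans (ler_norm_sum _ _ _)); apply: ler_sum => y _.
  rewrite normrM (ger0_norm (p_stoch.1 x y)) ler_wpM2l ?p_stoch.1// mulN1r.
  apply: tilted_increment_taylor => //.
  by rewrite /D -addrA ler_wpDl// lerD.
have /andP[lo up] := expR_near1 near1 tK.
have T0 : 0 <= expR (t ^+ 2 / 2 * v) * tilt t x by rewrite mulr_ge0 ?expR_ge0.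
have E z : expR (t ^+ 2 / 2 * v + z) * tilt t x =
  expR z * (expR (t ^+ 2 / 2 * v) * tilt t x) by rewrite mulrA -expRD [z + _]addrC.
rewrite -[2 * K * _]mulrA (E (- (2 * _))) (E (2 * _)).
by apply/andP; split; apply: ler_wpM2r.
Qed.

Lemma laplace_bounds_poisson : exists C t0 : R, [/\ 0 <= C, 0 < t0 &
  forall (t : R) n, `|t| <= t0 ->
    expR (n%:R * (t ^+ 2 / 2 * v - C * `|t| ^+ 3) - C)
      <= path_exp n.+1 (fun s => expR (t * path_sum f s))
      <= expR (n%:R * (t ^+ 2 / 2 * v + C * `|t| ^+ 3) + C)].
Proof.
have [K [t0 [K0 t00 t01 step]]] := tilt_step.
have [B B0 hB] := fin_bound (fun x => `|transition p g x| + `|k x| + `|f x|).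
have hb x : `|transition p g x| + `|k x| + `|f x| <= B.
  by apply: le_trans (hB x); exact: ler_norm.
(* [2 * B] accounts for the first state, which is not reached by a transition: its factor
   [expR (t * f x)] and its tilt. One more [B] removes the tilt at the last state. *)
exists (K + 3 * B), t0; split=> // [|t n ht].
  by rewrite addr_ge0 ?mulr_ge0.
have t1 : `|t| <= 1 by apply: le_trans t01.
have tt (c : R) : `|t * c| <= `|c| by rewrite normrM ler_piMl.
have tt2 (c : R) : `|t ^+ 2 * c| <= `|c|.
  by rewrite normrM normrX ler_piMl// exprn_ile1.
have tiltB x : `|t * transition p g x + t ^+ 2 * k x| <= B.
  apply: (le_trans (ler_normD _ _)); apply: le_trans (hb x); rewrite ler_wpDr//.
  exact: lerD.
have tfB x : `|t * f x| <= B.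
  by apply: le_trans (hb x); rewrite ler_wpDl.
have tilt_ge x : expR (- B) <= tilt t x.
  by rewrite ler_expR; have := tiltB x; rewrite ler_norml => /andP[].
have tilt_le x : tilt t x <= expR B.
  by rewrite ler_expR; have := tiltB x; rewrite ler_norml => /andP[].
have bnd : expR (n%:R * (t ^+ 2 / 2 * v - K * `|t| ^+ 3) - 2 * B)
      <= path_exp n.+1 (fun s => expR (t * path_sum f s) * tilt t (last x0 s))
      <= expR (n%:R * (t ^+ 2 / 2 * v + K * `|t| ^+ 3) + 2 * B).
  elim: n => [|n /andP[IH1 IH2]].
    rewrite path_exp1 !mul0r !add0r -{1}(path_exp_cst 1 (expR _)) path_exp1.
    rewrite -[X in _ <= _ <= X](path_exp_cst 1) path_exp1.
    by apply/andP; split; apply: ler_sum => x _; rewrite ler_wpM2l//=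
      /path_sum big_seq1 -expRD ler_expR;
      have := tfB x; have := tiltB x; rewrite !ler_norml => /andP[? ?] /andP[? ?]; lra.
  rewrite path_expS.
  have E s : transition p (fun y => expR (t * path_sum f (rcons s y)) *
        tilt t (last x0 (rcons s y))) (last x0 s) =
      expR (t * path_sum f s) * transition p (fun y => expR (t * f y) * tilt t y) (last x0 s).
    rewrite -transitionZ; apply: eq_transition => y.
    by rewrite path_sum_rcons last_rcons mulrDr expRD mulrA.
  have nS (c e : R) : n.+1%:R * c + e = c + (n%:R * c + e) by rewrite -natr1; ring.
  rewrite (eq_path_exp _ E) (nS (_ - _)) (nS (_ + _)) (expRD (_ - _)) (expRD (_ + _ * _)).
  apply/andP; split.
    apply: (@le_trans _ _ (expR (t ^+ 2 / 2 * v - K * `|t| ^+ 3) *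
      path_exp n.+1 (fun s => expR (t * path_sum f s) * tilt t (last x0 s)))).
      by rewrite ler_wpM2l ?expR_ge0.
    rewrite -path_expZ; apply: le_path_exp => s; rewrite mulrCA ler_wpM2l ?expR_ge0//.
    by have /andP[] := step t ht (last x0 s).
  apply: (@le_trans _ _ (expR (t ^+ 2 / 2 * v + K * `|t| ^+ 3) *
    path_exp n.+1 (fun s => expR (t * path_sum f s) * tilt t (last x0 s)))).
    rewrite -path_expZ; apply: le_path_exp => s; rewrite mulrCA ler_wpM2l ?expR_ge0//.
    by have /andP[] := step t ht (last x0 s).
  by rewrite ler_wpM2l ?expR_ge0.
have /andP[lo up] := bnd.
have t30 : 0 <= B * `|t| ^+ 3 by rewrite mulr_ge0 ?exprn_ge0.
have nt30 : 0 <= n%:R * (B * `|t| ^+ 3) by rewrite mulr_ge0.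
apply/andP; split.
  apply: (@le_trans _ _ (expR (- B) *
      path_exp n.+1 (fun s => expR (t * path_sum f s) * tilt t (last x0 s)))).
    apply: (@le_trans _ _ (expR (- B) * expR (n%:R * (t ^+ 2 / 2 * v - K * `|t| ^+ 3) - 2 * B))).
      by rewrite -expRD ler_expR; lra.
    by rewrite ler_wpM2l ?expR_ge0.
  rewrite -path_expZ; apply: le_path_exp => s; rewrite mulrCA ler_piMr ?expR_ge0//.
  by rewrite -(expR0 R) -(addNr B) expRD ler_wpM2l ?expR_ge0.
apply: (@le_trans _ _ (expR B *
    path_exp n.+1 (fun s => expR (t * path_sum f s) * tilt t (last x0 s)))).
  rewrite -path_expZ; apply: le_path_exp => s; rewrite mulrCA ler_peMr ?expR_ge0//.
  by rewrite -(expR0 R) -(subrr B) expRD ler_wpM2l ?expR_ge0.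
apply: (@le_trans _ _ (expR B * expR (n%:R * (t ^+ 2 / 2 * v + K * `|t| ^+ 3) + 2 * B))).
  by rewrite ler_wpM2l ?expR_ge0.
by rewrite -expRD ler_expR; lra.
Qed.

End LaplaceBounds.

End PathExpectation.

(** * Moments and tails of additive functionals and occupation numbers *)

Section StationaryChainSums.
Context (R : realType) (S : finType) (p : S -> S -> R) (pi : S -> R).
Hypothesis p_stoch : stochastic p.
Hypothesis p_irr : irreducible_chain p.
Hypothesis pi_ge0 : forall x, 0 <= pi x.
Hypothesis pi_sum1 : \sum_x pi x = 1.
Hypothesis pi_inv : forall y, \sum_x pi x * p x y = pi y.
Context (x0 : S).

Lemma path_exp_path_sum f n : path_exp p pi n (path_sum f) = n%:R * \sum_x pi x * f x.
Proof.
case: n => [|n].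
  rewrite mul0r /path_exp /fexp big1// => -[[|//] ?] _.
  by rewrite /path_sum /= big_nil mulr0.
elim: n => [|n IH].
  rewrite (path_exp1 _ _ x0) mul1r; apply: eq_bigr => x _.
  by rewrite /path_sum big_seq1.
rewrite (path_expS _ _ x0) -natr1 mulrDl mul1r -IH.
rewrite -(sum_pi_transition pi_inv f) -(path_exp_last pi_inv x0 n (transition p f)).
rewrite -path_expD; apply: eq_path_exp => s.
rewrite (@eq_transition _ _ _ _ (fun y => path_sum f s + f y)).
  by rewrite (transitionD p (fun=> path_sum f s)) (transition_cst p_stoch).
by move=> y; rewrite path_sum_rcons.
Qed.

Lemma laplace_bounds f : \sum_x pi x * f x = 0 ->
  exists (g : S -> R) (C t0 : R), [/\ forall x, g x - transition p g x = f x,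
    0 <= C, 0 < t0, t0 <= 1 &
    forall (t : R) n, (0 < n)%N -> `|t| <= t0 ->
      expR (n%:R * (t ^+ 2 / 2 * asymptotic_variance p pi g - C * `|t| ^+ 3) - C)
        <= path_exp p pi n (fun s => expR (t * path_sum f s))
        <= expR (n%:R * (t ^+ 2 / 2 * asymptotic_variance p pi g + C * `|t| ^+ 3) + C)].
Proof.
move=> f0; have [g gf] := poisson_equation p_stoch p_irr pi_sum1 pi_inv f0.
set v := asymptotic_variance p pi g.
have v0 : 0 <= v := asymptotic_variance_ge0 p_stoch pi_ge0 g.
have [k kE] : exists k : S -> R, forall x, k x - transition p k x = (cond_var p g x - v) / 2.
  apply: (poisson_equation p_stoch p_irr pi_sum1 pi_inv).
  under eq_bigr do rewrite mulrA mulrBr.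
  by rewrite -mulr_suml sumrB -mulr_suml pi_sum1 mul1r subrr mul0r.
have [C [t0 [C0 t00 h]]] := laplace_bounds_poisson p_stoch pi_ge0 pi_sum1 x0 gf kE.
(* A path of [n] states makes [n - 1] transitions; since [|t| <= 1], adding [v] to the constant
   covers the missing term [t ^+ 2 / 2 * v]. *)
exists g, (C + v), (Num.min t0 1); split=> //.
- exact: addr_ge0.
- by rewrite lt_min t00 ltr01.
- by rewrite ge_min lexx orbT.
move=> t [//|n] _; rewrite le_min => /andP[/(h t n)/andP[lo up] t1].
have t3 : 0 <= `|t| ^+ 3 by rewrite exprn_ge0.
have t2 : t ^+ 2 <= 1 by rewrite -real_normK ?num_real// exprn_ile1.
have Ct3 := mulr_ge0 C0 t3; have vt3 := mulr_ge0 v0 t3.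
have nvt3 := mulr_ge0 (ler0n R n) vt3.
have vt2 := ler_wpM2l v0 t2; have vt2' := mulr_ge0 v0 (sqr_ge0 t).
rewrite -natr1; apply/andP; split.
  by apply: le_trans lo; rewrite ler_expR -/v; lra.
by apply: (le_trans up); rewrite ler_expR -/v; lra.
Qed.

(** A single constant [D] limits the range of [t] and bounds both the prefactor and the variance.
    The bound stays valid when [D] grows, so it can be made uniform over the finitely many
    states. *)
Lemma exp_moment_bound f : \sum_x pi x * f x = 0 ->
  exists2 D : R, 1 <= D & forall (t : R) n, (0 < n)%N -> D * `|t| <= 1 ->
    path_exp p pi n (fun s => expR (t * path_sum f s)) <= expR (D * (1 + n%:R * t ^+ 2)).
Proof.
move=> /laplace_bounds[g [C [t0 [_ C0 t00 t01 h]]]].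
set v := asymptotic_variance p pi g in h.
have v0 : 0 <= v := asymptotic_variance_ge0 p_stoch pi_ge0 g.
have it0 : 0 <= t0^-1 by rewrite invr_ge0 ltW.
exists (1 + t0^-1 + C + v) => [|t n n0 tD].
  by rewrite -!addrA lerDl !addr_ge0.
have tt0 : `|t| <= t0.
  have : t0^-1 * `|t| <= 1.
    apply: le_trans tD; rewrite ler_wpM2r// -addrA [1 + _]addrC -addrA lerDl.
    by rewrite !addr_ge0.
  by rewrite ler_pdivrMl// mulr1.
have /andP[_ up] := h t n n0 tt0; apply: (le_trans up); rewrite ler_expR.
have t3 : `|t| ^+ 3 <= t ^+ 2.
  rewrite -[t ^+ 2]real_normK ?num_real// exprS ler_piMl ?exprn_ge0//.
  exact: le_trans t01.
have nC := mulr_ge0 (ler0n R n) C0.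
have h1 := ler_wpM2l nC t3.
have h2 := mulr_ge0 (ler0n R n) (mulr_ge0 (sqr_ge0 t) v0).
have h3 := mulr_ge0 (ler0n R n) (mulr_ge0 (sqr_ge0 t) it0).
have h4 := mulr_ge0 (ler0n R n) (sqr_ge0 t).
lra.
Qed.

Lemma fourth_moment_bound f : \sum_x pi x * f x = 0 ->
  exists2 C : R, 0 <= C & forall n, (0 < n)%N ->
    path_exp p pi n (fun s => path_sum f s ^+ 4) <= C * n%:R ^+ 2.
Proof.
move=> /exp_moment_bound[D D1 h]; have D0 : 0 < D by apply: lt_le_trans D1.
exists (48 * D ^+ 4 * expR (2 * D)) => [|n n0].
  by rewrite !mulr_ge0 ?exprn_ge0 ?expR_ge0// ltW.
have nR : 0 < n%:R :> R by rewrite ltr0n.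
have n1 : 1 <= n%:R :> R by rewrite ler1n.
(* At order [n ^ (- 1/2)] the exponential moments at [t] and [- t] stay bounded; the fourth moment
   is then of order [t ^ (- 4)], that is [n ^ 2]. *)
pose t := (D * Num.sqrt n%:R)^-1.
have sn : 0 < Num.sqrt n%:R :> R by rewrite sqrtr_gt0.
have t0 : 0 < t by rewrite invr_gt0 mulr_gt0.
have t2 : n%:R * t ^+ 2 = (D ^+ 2)^-1.
  rewrite /t exprVn exprMn sqr_sqrtr ?ltW// invfM mulrCA divff ?mulr1 ?gt_eqF//.
have D2 : D * (1 + n%:R * t ^+ 2) <= 2 * D.
  rewrite t2 mulrDr mulr1 mulrDl mul1r lerD2l ger_pMr// invf_le1 ?exprn_gt0//.
  exact: exprn_ege1.
have Dt : D * t <= 1.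
  rewrite /t invfM mulrA divff ?gt_eqF// mul1r invf_le1//.
  by rewrite -{1}sqrtr1 ler_wsqrtr.
have E1 := h t n n0; have E2 := h (- t) n n0.
rewrite normrN sqrrN !(ger0_norm (ltW t0)) in E1 E2.
have {}E1 := le_trans (E1 Dt) (eq_ind_r (fun b : bool => b) D2 (ler_expR _ _)).
have {}E2 := le_trans (E2 Dt) (eq_ind_r (fun b : bool => b) D2 (ler_expR _ _)).
have t4 : t ^+ 4 = (D ^+ 4 * n%:R ^+ 2)^-1.
  rewrite /t exprVn exprMn; congr (_ * _)^-1.
  by rewrite (exprM _ 2 2) sqr_sqrtr ?ltW.
have : t ^+ 4 * path_exp p pi n (fun s => path_sum f s ^+ 4) <= 48 * expR (2 * D).
  rewrite -path_expZ; apply: (@le_trans _ _ (path_exp p pi n (fun s =>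
    24 * (expR (t * path_sum f s) + expR (- t * path_sum f s))))).
    apply: (le_path_exp p_stoch pi_ge0) => s; rewrite -exprMn mulNr.
    exact: expr4_le_expR.
  by rewrite path_expZ path_expD; lra.
rewrite t4 ler_pdivrMl ?mulr_gt0 ?exprn_gt0//; lra.
Qed.

Lemma fin_uniform (I : finType) (P : I -> R -> Prop) :
  (forall i D D', D <= D' -> P i D -> P i D') ->
  (forall i, exists2 D, 1 <= D & P i D) -> exists2 D, 1 <= D & forall i, P i D.
Proof.
move=> Pmono hP.
have /choice[D hD] : forall i, exists D : R, 1 <= D /\ P i D.
  by move=> i; have [D D1 PD] := hP i; exists D.
have D0 i : 0 <= D i by apply: le_trans (hD i).1.
exists (1 + \sum_i D i) => [|i]; first by rewrite lerDl sumr_ge0.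
apply: Pmono (hD i).2; by rewrite (bigD1 i)//= addrCA lerDl addr_ge0// sumr_ge0.
Qed.

Definition centered_visit (m : S -> R) (x a : S) : R := (a == x)%:R - m x.

Definition visit_sqdev (m : S -> R) (s : seq S) : R :=
  \sum_x path_sum (centered_visit m x) s ^+ 2.

Lemma visit_sqdev_ge0 m s : 0 <= visit_sqdev m s.
Proof. by apply: sumr_ge0 => x _; exact: sqr_ge0. Qed.

Lemma centered_visit_mean x : \sum_a pi a * centered_visit pi x a = 0.
Proof.
under eq_bigr do rewrite mulrBr.
rewrite sumrB -mulr_suml pi_sum1 mul1r (bigD1 x)//= eqxx mulr1 big1 ?addr0 ?subrr//.
by move=> a /negPf ->; rewrite mulr0.
Qed.

Lemma sqr_sum_le (I : finType) (u : I -> R) :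
  (\sum_i u i) ^+ 2 <= #|I|%:R * \sum_i u i ^+ 2.
Proof.
have : 0 <= \sum_i \sum_j (u i - u j) ^+ 2.
  by apply: sumr_ge0 => i _; apply: sumr_ge0 => j _; exact: sqr_ge0.
have -> : \sum_i \sum_j (u i - u j) ^+ 2 =
    2 * (#|I|%:R * \sum_i u i ^+ 2 - (\sum_i u i) ^+ 2).
  under eq_bigr => i _.
    under eq_bigr do rewrite sqrrB addrAC.
    rewrite sumrB big_split/= sumr_const -mulr_natl.
    under [X in _ - X]eq_bigr do rewrite -mulr_natl mulrA.
    rewrite -mulr_sumr; over.
  rewrite sumrB big_split/= -mulr_sumr sumr_const -mulr_natl -mulr_suml.
  by rewrite -mulr_sumr; ring.
by rewrite pmulr_rge0// subr_ge0.
Qed.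

Lemma visit_sqdev_sqr_moment : exists2 C : R, 0 <= C & forall n, (0 < n)%N ->
  path_exp p pi n (fun s => visit_sqdev pi s ^+ 2) <= C * n%:R ^+ 2.
Proof.
have [C C1 hC] : exists2 C, 1 <= C & forall x n, (0 < n)%N ->
    path_exp p pi n (fun s => path_sum (centered_visit pi x) s ^+ 4) <= C * n%:R ^+ 2.
  apply: (@fin_uniform _ (fun x C => forall n, (0 < n)%N ->
    path_exp p pi n (fun s => path_sum (centered_visit pi x) s ^+ 4) <= C * n%:R ^+ 2)).
    by move=> x D D' DD' h n n0; apply: (le_trans (h n n0)); rewrite ler_wpM2r ?exprn_ge0.
  move=> x; have [C C0 h] := fourth_moment_bound (centered_visit_mean x).
  exists (1 + C) => [|n n0]; first by rewrite lerDl.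
  by apply: (le_trans (h n n0)); rewrite ler_wpM2r ?exprn_ge0// lerDr.
exists (#|S|%:R * (#|S|%:R * C)) => [|n n0].
  by rewrite !mulr_ge0//; apply: le_trans C1.
apply: (@le_trans _ _ (path_exp p pi n (fun s =>
  #|S|%:R * \sum_x path_sum (centered_visit pi x) s ^+ 4))).
  apply: (le_path_exp p_stoch pi_ge0) => s; apply: (le_trans (sqr_sum_le _)).
  by rewrite ler_wpM2l// ler_sum// => x _; rewrite -exprM.
rewrite path_expZ -!mulrA ler_wpM2l// /path_exp fexp_sum.
apply: (le_trans (ler_sum _ (fun x _ => hC x n n0))).
by rewrite sumr_const -[_ *+ #|_|]mulr_natl.
Qed.

Lemma visit_sqdev_moment : exists2 C : R, 0 <= C & forall n, (0 < n)%N ->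
  path_exp p pi n (visit_sqdev pi) <= C * n%:R.
Proof.
have [C C0 h] := visit_sqdev_sqr_moment; exists (1 + C) => [|n n0].
  exact: addr_ge0.
have nR : 0 < n%:R :> R by rewrite ltr0n.
apply: (@le_trans _ _ (path_exp p pi n (fun s => n%:R + n%:R^-1 * visit_sqdev pi s ^+ 2))).
  apply: (le_path_exp p_stoch pi_ge0) => s.
  rewrite -(ler_pM2l nR) mulrDr mulrA divff ?gt_eqF// mul1r.
  by have := sqr_ge0 (n%:R - visit_sqdev pi s); have := visit_sqdev_ge0 pi s; nra.
rewrite path_expD path_expZ (path_exp_cst p_stoch pi_sum1 x0) mulrDl mul1r lerD2l.
by rewrite ler_pdivrMl// mulrC -mulrA -expr2 h.
Qed.

(** If the sum of squares reaches [#|S| * q], some square reaches [q]; a union bound over states and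
    signs leads to Chernoff's inequality for one coordinate. *)
Lemma visit_sqdev_tail : exists2 D : R, 1 <= D & forall n (q : R), (0 < n)%N ->
  0 <= q -> q <= 4 * n%:R ^+ 2 ->
  fprob (fun t : n.-tuple S => path_weight p pi t)
      (fun t => #|S|%:R * q <= visit_sqdev pi t)
    <= 2 * #|S|%:R * expR (D - q / (4 * D * n%:R)).
Proof.
have [D D1 hD] : exists2 D, 1 <= D & forall x (t : R) n, (0 < n)%N -> D * `|t| <= 1 ->
    path_exp p pi n (fun s => expR (t * path_sum (centered_visit pi x) s))
      <= expR (D * (1 + n%:R * t ^+ 2)).
  apply: (@fin_uniform _ (fun x D => forall (t : R) n, (0 < n)%N -> D * `|t| <= 1 ->
    path_exp p pi n (fun s => expR (t * path_sum (centered_visit pi x) s))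
      <= expR (D * (1 + n%:R * t ^+ 2)))) => [x D D' DD' h t n n0 tD'|x].
    apply: (le_trans (h t n n0 _)).
      by apply: le_trans tD'; rewrite ler_wpM2r.
    by rewrite ler_expR ler_wpM2r// addr_ge0// mulr_ge0 ?sqr_ge0.
  exact: exp_moment_bound (centered_visit_mean x).
exists D => // n q n0 q0 q4.
have D0 : 0 < D by apply: lt_le_trans D1.
have nR : 0 < n%:R :> R by rewrite ltr0n.
pose tau := Num.sqrt q; have tau0 : 0 <= tau := sqrtr_ge0 q.
have tauq : tau ^+ 2 = q by rewrite sqr_sqrtr.
(* The minimiser of [D * n * t ^+ 2 - t * tau], with value [- q / (4 * D * n)]; the assumption
   [q <= 4 * n ^+ 2] keeps it in the range [D * t <= 1]. *)
pose t := tau / (2 * D * n%:R).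
have t0 : 0 <= t by rewrite divr_ge0 ?mulr_ge0// ltW.
have Dt : D * `|t| <= 1.
  have E : D * t = tau / (2 * n%:R) by rewrite /t; field; rewrite !gt_eqF.
  rewrite ger0_norm// E.
  rewrite ler_pdivrMr ?mulr_gt0// mul1r -(@ler_pXn2r _ 2)// ?nnegrE// ?mulr_ge0//.
  by rewrite tauq exprMn -natrX.
have S0 : (0 < #|S|)%N by apply/card_gt0P; exists x0.
rewrite -(ler_pM2l (expR_gt0 (t * tau))).
apply: (@le_trans _ _ (path_exp p pi n (fun s =>
  \sum_x (expR (t * path_sum (centered_visit pi x) s) +
          expR (- t * path_sum (centered_visit pi x) s))))).
  rewrite /path_exp; apply: fprob_markov => [s|s|s]; first exact: path_weight_ge0.
    by apply: sumr_ge0 => x _; rewrite addr_ge0 ?expR_ge0.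
  move=> qV.
  have [x qx] : exists x, q <= path_sum (centered_visit pi x) s ^+ 2.
    apply/not_existsP => nq; move: qV; apply/negP; rewrite -ltNge.
    rewrite mulr_natl -sumr_const; apply: ltr_sum => [|x _].
      by apply/hasP; exists x0; rewrite ?mem_index_enum.
    by rewrite ltNge; apply/negP/nq.
  rewrite (bigD1 x)//= -[leLHS]addr0 lerD//; last first.
    by apply: sumr_ge0 => y _; rewrite addr_ge0 ?expR_ge0.
  have : tau <= `|path_sum (centered_visit pi x) s|.
    by rewrite -sqrtr_sqr ler_wsqrtr.
  rewrite ler_normr => /orP[h|h].
    by rewrite -[leLHS]addr0 lerD ?expR_ge0// ler_expR ler_wpM2l.
  by rewrite -[leLHS]add0r lerD ?expR_ge0// ler_expR mulNr -mulrN ler_wpM2l.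
rewrite /path_exp fexp_sum.
have hx x : fexp (fun t : n.-tuple S => path_weight p pi t) (fun s =>
    expR (t * path_sum (centered_visit pi x) s) +
    expR (- t * path_sum (centered_visit pi x) s)) <= 2 * expR (D * (1 + n%:R * t ^+ 2)).
  have h1 := hD x t n n0 Dt; have := hD x (- t) n n0.
  rewrite normrN sqrrN => /(_ Dt) h2.
  by rewrite fexpD; move: h1 h2; rewrite /path_exp; lra.
apply: (le_trans (ler_sum _ (fun x _ => hx x))).
have -> : D * (1 + n%:R * t ^+ 2) = t * tau + (D - q / (4 * D * n%:R)).
  have -> : t * tau = q / (2 * D * n%:R) by rewrite /t -tauq; ring.
  have -> : t ^+ 2 = q / (2 * D * n%:R) ^+ 2 by rewrite /t -tauq expr_div_n.
  by field; rewrite !gt_eqF.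
rewrite sumr_const (_ : #|_| = #|S|)// -[_ *+ #|_|]mulr_natl (expRD (t * tau)).
by rewrite le_eqVlt; apply/orP; left; apply/eqP; ring.
Qed.

End StationaryChainSums.

(** * Hoeffding's decomposition *)

Section HoeffdingDecomposition.
Context (R : realType) (S : finType) (pi : S -> R) (h : S -> S -> R) (x0 : S).
Hypothesis pi_sum1 : \sum_x pi x = 1.
Hypothesis h_sym : forall x y, h x y = h y x.

Definition kernel_proj (m : S -> R) (k : S -> S -> R) (x : S) : R := \sum_y m y * k x y.

Definition kernel_mean (m : S -> R) (k : S -> S -> R) : R :=
  \sum_x m x * kernel_proj m k x.

Definition kernel_canonical (m : S -> R) (k : S -> S -> R) (x y : S) : R :=
  k x y - kernel_proj m k x - kernel_proj m k y + kernel_mean m k.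

(** The factor 2 is the degree: each argument of the kernel contributes one projection. *)
Definition linear_part (m : S -> R) (k : S -> S -> R) (x : S) : R :=
  2 * (kernel_proj m k x - kernel_mean m k).

Definition path_Ustat (k : S -> S -> R) (s : seq S) : R :=
  ('C(size s, 2)%:R)^-1 *
  \sum_(i < size s) \sum_(j < size s | (i < j)%N) k (nth x0 s i) (nth x0 s j).

Local Notation theta := (kernel_mean pi h).
Local Notation h1 := (kernel_proj pi h).
Local Notation h2 := (kernel_canonical pi h).

Lemma linear_part_mean : \sum_x pi x * linear_part pi h x = 0.
Proof.
under eq_bigr do rewrite mulrCA mulrBr.
by rewrite -mulr_sumr sumrB -mulr_suml pi_sum1 mul1r subrr mulr0.
Qed.

Lemma kernel_canonical_mean y : \sum_x pi x * h2 x y = 0.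
Proof.
under eq_bigr do rewrite /kernel_canonical mulrDr mulrBr mulrBr.
rewrite big_split /= !sumrB -!mulr_suml pi_sum1 !mul1r.
rewrite (eq_bigr (fun x => pi x * h y x)) => [|x _]; last by rewrite h_sym.
rewrite -/(kernel_proj pi h y) -/(kernel_mean pi h); ring.
Qed.

Lemma kernel_canonical_sym x y : h2 x y = h2 y x.
Proof. by rewrite /kernel_canonical h_sym; ring. Qed.

Lemma sum_centered_visit a (u : S -> R) :
  \sum_x centered_visit pi x a * u x = u a - \sum_x pi x * u x.
Proof.
under eq_bigr do rewrite mulrBl.
rewrite sumrB (bigD1 a)//= eqxx mul1r big1 ?addr0// => x /negPf.
by rewrite eq_sym => ->; rewrite mul0r.
Qed.

(** As [h2] has mean 0 in each variable, centering the indicators of [a] and [b] changes nothing.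
    The variables are thereby separated, and sums of [h2] over pairs become products of path
    sums. *)
Lemma kernel_canonical_expand a b :
  h2 a b = \sum_x \sum_y centered_visit pi x a * (centered_visit pi y b * h2 x y).
Proof.
under eq_bigr => x _.
  rewrite -mulr_sumr sum_centered_visit.
  under [X in _ - X]eq_bigr do rewrite kernel_canonical_sym.
  rewrite kernel_canonical_mean subr0; over.
by rewrite sum_centered_visit kernel_canonical_mean subr0.
Qed.

(** Ordered pairs with the diagonal included, so that the double sum factors; [path_UstatE] takes
    the diagonal off again. *)
Definition pair_sum (k : S -> S -> R) (s : seq S) : R := \sum_(a <- s) \sum_(b <- s) k a b.

Lemma pair_sum_canonical s : pair_sum h2 s =
  \sum_x \sum_y h2 x y * (path_sum (centered_visit pi x) s * path_sum (centered_visit pi y) s).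
Proof.
rewrite /pair_sum; under eq_bigr do under eq_bigr do rewrite kernel_canonical_expand.
under eq_bigr do rewrite exchange_big.
rewrite exchange_big /=; apply: eq_bigr => x _.
under eq_bigr do rewrite exchange_big.
rewrite exchange_big /=; apply: eq_bigr => y _.
rewrite mulrCA /path_sum mulr_suml; apply: eq_bigr => a _.
by rewrite mulr_sumr mulr_sumr; apply: eq_bigr => b _; ring.
Qed.

Lemma sum_const_seq (s : seq S) (c : R) : \sum_(a <- s) c = (size s)%:R * c.
Proof. by rewrite big_const_seq count_predT iter_addr_0 mulr_natl. Qed.

Lemma pair_sum_decomp s : pair_sum h s =
  (size s)%:R ^+ 2 * theta + (size s)%:R * path_sum (linear_part pi h) s + pair_sum h2 s.
Proof.
have E a b : h a b = (linear_part pi h a / 2 + (linear_part pi h b / 2 + theta)) + h2 a b.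
  by rewrite /linear_part /kernel_canonical; field.
rewrite /pair_sum; under eq_bigr do under eq_bigr do rewrite E.
under eq_bigr do rewrite big_split big_split big_split !sum_const_seq /=.
rewrite big_split big_split big_split/= !sum_const_seq -mulr_sumr -!mulr_suml.
by rewrite /path_sum; field.
Qed.

Lemma sum_ltn_sym n (F : 'I_n -> 'I_n -> R) : (forall i j, F i j = F j i) ->
  2 * \sum_(i < n) \sum_(j < n | (i < j)%N) F i j =
    \sum_(i < n) \sum_(j < n) F i j - \sum_(i < n) F i i.
Proof.
move=> Fsym.
have -> : \sum_(i < n) \sum_(j < n) F i j = \sum_(i < n) (F i i +
    (\sum_(j < n | (i < j)%N) F i j + \sum_(j < n | (j < i)%N) F i j)).
  apply: eq_bigr => i _; rewrite (bigD1 i)//=; congr (_ + _).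
  rewrite (bigID (fun j : 'I_n => (i < j)%N))/=; congr (_ + _); apply: eq_bigl => j.
    by rewrite -val_eqE/= neq_ltn; case: ltngtP.
  by rewrite -val_eqE/= neq_ltn; case: ltngtP.
rewrite big_split big_split/= addrAC subrr add0r mulrDl mul1r; congr (_ + _).
rewrite [RHS](exchange_big_dep xpredT)//=; apply: eq_bigr => i _.
by apply: eq_bigr => j _; rewrite Fsym.
Qed.

Lemma path_UstatE s : (1 < size s)%N ->
  path_Ustat h s = (pair_sum h s - \sum_(a <- s) h a a) / ((size s)%:R * ((size s)%:R - 1)).
Proof.
move=> s1; rewrite /path_Ustat.
have -> : pair_sum h s = \sum_(i < size s) \sum_(j < size s) h (nth x0 s i) (nth x0 s j).
  rewrite /pair_sum (big_nth x0) big_mkord; apply: eq_bigr => i _.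
  by rewrite (big_nth x0) big_mkord.
have -> : \sum_(a <- s) h a a = \sum_(i < size s) h (nth x0 s i) (nth x0 s i).
  by rewrite (big_nth x0) big_mkord.
rewrite -sum_ltn_sym; last by move=> i j; rewrite h_sym.
have binE : 'C(size s, 2)%:R * 2 = (size s)%:R * ((size s)%:R - 1) :> R.
  have := bin_ffact (size s) 2; rewrite ffactnS ffactn1 => /(congr1 (GRing.natmul (1 : R))).
  rewrite !natrM => ->; congr (_ * _).
  by rewrite -[in RHS](prednK (ltnW s1)) -natr1 addrK.
have b0 : ('C(size s, 2)%:R : R) != 0 by rewrite pnatr_eq0 -lt0n bin_gt0.
by rewrite -binE; field.
Qed.

Lemma Ustat_linearization : exists2 C : R, 0 <= C & forall s, (1 < size s)%N ->
  `|(size s)%:R * (path_Ustat h s - theta) - path_sum (linear_part pi h) s|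
    <= C * (1 + visit_sqdev pi s / (size s)%:R).
Proof.
have [B1 B10 hB1] := fin_bound (linear_part pi h).
have [B2 B20 hB2] := fin_bound2 h2.
have [B3 B30 hB3] := fin_bound (fun x => h x x).
pose K := B1 + `|theta| + B3.
have K0 : 0 <= K by rewrite !addr_ge0.
exists (2 * (K + B2 * #|S|%:R)) => [|s s1].
  by rewrite mulr_ge0// addr_ge0 ?mulr_ge0.
rewrite path_UstatE// pair_sum_decomp.
set N := (size s)%:R : R; set L := path_sum _ s; set Q := pair_sum h2 s.
set H := \sum_(a <- s) h a a; set V := visit_sqdev pi s.
have N2 : 2 <= N by rewrite ler_nat.
have N0 : 0 < N by apply: lt_le_trans N2.
have N1 : 0 < N - 1 by lra.
have V0 : 0 <= V := visit_sqdev_ge0 pi s.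
have bndS (u : S -> R) B : (forall x, `|u x| <= B) -> `|\sum_(a <- s) u a| <= N * B.
  move=> hu; rewrite -sum_const_seq; apply: (le_trans (ler_norm_sum _ _ _)).
  exact: ler_sum.
have hL : `|L| <= N * B1 by exact: bndS.
have hH : `|H| <= N * B3 by exact: (bndS (fun x => h x x)).
have hQ : `|Q| <= B2 * #|S|%:R * V.
  rewrite /Q pair_sum_canonical.
  pose w x := `|path_sum (centered_visit pi x) s|.
  apply: (@le_trans _ _ (\sum_x \sum_y B2 * (w x * w y))).
    apply: (le_trans (ler_norm_sum _ _ _)); apply: ler_sum => x _.
    apply: (le_trans (ler_norm_sum _ _ _)); apply: ler_sum => y _.
    by rewrite !normrM ler_wpM2r ?mulr_ge0.
  under eq_bigr do rewrite -mulr_sumr -mulr_sumr.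
  rewrite -mulr_sumr -mulr_suml -mulrA ler_wpM2l//.
  apply: (le_trans (sqr_sum_le w)); rewrite ler_wpM2l// ler_sum// => x _.
  by rewrite /w real_normK ?num_real.
(* [L + N * theta] results from the normalisation by [N - 1] instead of [N]. Like the diagonal [H]
   it is [O (N)], hence bounded after division; [Q] alone needs the occupation numbers. *)
have -> : N * ((N ^+ 2 * theta + N * L + Q - H) / (N * (N - 1)) - theta) - L =
    (L + N * theta + Q - H) / (N - 1) by field; rewrite !gt_eqF.
have num : `|L + N * theta + Q - H| <= N * K + B2 * #|S|%:R * V.
  have hT : `|N * theta| <= N * `|theta| by rewrite normrM gtr0_norm.
  have := ler_normB (L + N * theta + Q) H; have := ler_normD (L + N * theta) Q.
  by have := ler_normD L (N * theta); rewrite /K; lra.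
rewrite normrM normfV (gtr0_norm N1) ler_pdivrMr//.
apply: (le_trans num).
have W0 : 0 <= V / N by rewrite divr_ge0// ltW.
have BV : 0 <= B2 * #|S|%:R * (V / N) by rewrite mulr_ge0// mulr_ge0.
have BK : 0 <= B2 * #|S|%:R by rewrite mulr_ge0.
have VE : V = N * (V / N) by rewrite mulrC divfK ?gt_eqF.
set T := B2 * #|S|%:R in BV BK *; set Y := V / N in W0 BV VE *; rewrite VE.
apply: (@le_trans _ _ (2 * (K + T * Y) * (N - 1))).
  have -> : N * K + T * (N * Y) = (K + T * Y) * N by ring.
  have : 0 <= K + T * Y by rewrite addr_ge0.
  move=> KT; have -> : 2 * (K + T * Y) * (N - 1) = (K + T * Y) * (2 * (N - 1)) by ring.
  by rewrite ler_wpM2l//; lra.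
by rewrite ler_wpM2r ?(ltW N1)//; have := mulr_ge0 K0 W0; lra.
Qed.

End HoeffdingDecomposition.

(** * Variance limit and moderate deviation estimates for the U-statistic along stationary paths *)

Section UstatModerateDeviations.
Context (R : realType) (S : finType) (p : S -> S -> R) (pi : S -> R).
Hypothesis p_stoch : stochastic p.
Hypothesis p_irr : irreducible_chain p.
Hypothesis pi_ge0 : forall x, 0 <= pi x.
Hypothesis pi_sum1 : \sum_x pi x = 1.
Hypothesis pi_inv : forall y, \sum_x pi x * p x y = pi y.
Context (x0 : S) (h : S -> S -> R).
Hypothesis h_sym : forall x y, h x y = h y x.

Local Notation f := (linear_part pi h).
Local Notation theta := (kernel_mean pi h).
Local Notation U := (path_Ustat x0 h).
Local Notation V := (visit_sqdev pi).

Lemma le_path_exp_size n F G : (forall s, size s = n -> F s <= G s) ->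
  path_exp p pi n F <= path_exp p pi n G.
Proof.
move=> FG; apply: le_fexp => t; first exact: path_weight_ge0.
by rewrite FG// size_tuple.
Qed.

Lemma normr_path_exp n F : `|path_exp p pi n F| <= path_exp p pi n (fun s => `|F s|).
Proof.
rewrite ler_norml; apply/andP; split.
  by rewrite -path_expN; apply: le_path_exp => // s; rewrite lerNl -normrN ler_norm.
by apply: le_path_exp => // s; exact: ler_norm.
Qed.

(** Dependence makes the mean of the U-statistic differ from [theta]. As the linear part is
    centered, [n] times the difference is the mean of the remainder, which the first moment of [V]
    bounds uniformly in [n]. *)
Lemma centered_Ustat_linearization : exists2 C : R, 0 <= C & forall n, (1 < n)%N ->
  forall s, size s = n ->
    `|n%:R * (U s - path_exp p pi n U) - path_sum f s| <= C * (1 + V s / n%:R).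
Proof.
have [C C0 hC] := Ustat_linearization x0 pi_sum1 h_sym.
have [D D0 hD] := visit_sqdev_moment p_stoch p_irr pi_ge0 pi_sum1 pi_inv x0.
exists (C * (2 + D)) => [|n n1 s sn]; first by rewrite mulr_ge0 ?addr_ge0.
have n0 : 0 < n%:R :> R by rewrite ltr0n ltnW.
pose rho s := n%:R * (U s - theta) - path_sum f s.
have rho_le s' : size s' = n -> `|rho s'| <= C * (1 + V s' / n%:R).
  by move=> s'n; have := hC s'; rewrite s'n; exact.
have mean_rho : n%:R * (path_exp p pi n U - theta) = path_exp p pi n rho.
  rewrite /rho path_expD path_expZ path_expD !path_expN.
  rewrite (path_exp_path_sum p_stoch pi_inv x0) linear_part_mean// mulr0 oppr0 addr0.
  by rewrite (path_exp_cst p_stoch pi_sum1 x0).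
have Erho : `|path_exp p pi n rho| <= C * (1 + D).
  apply: (le_trans (normr_path_exp _ _)).
  apply: (le_trans (le_path_exp_size rho_le)).
  rewrite path_expZ ler_wpM2l// path_expD (path_exp_cst p_stoch pi_sum1 x0) lerD2l.
  under eq_path_exp do rewrite mulrC.
  by rewrite path_expZ ler_pdivrMl// mulrC hD// ltnW.
have -> : n%:R * (U s - path_exp p pi n U) - path_sum f s = rho s - path_exp p pi n rho.
  by rewrite -mean_rho /rho; ring.
apply: (le_trans (ler_normB _ _)); have hr := rho_le s sn.
have V0 : 0 <= C * (V s / n%:R).
  by rewrite mulr_ge0 ?divr_ge0 ?visit_sqdev_ge0.
by have := mulr_ge0 (mulr_ge0 C0 D0) V0; have := mulr_ge0 D0 V0; lra.
Qed.

(** The scaled deviation differs from the martingale [M] by an [r] bounded in [L^2], while the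
    second moment of [M] is known exactly. *)
Lemma Ustat_variance_rate (g : S -> R) : (forall x, g x - transition p g x = f x) ->
  exists K : R, forall n, (1 < n)%N ->
    `|n%:R * path_exp p pi n (fun s => (U s - path_exp p pi n U) ^+ 2)
      - asymptotic_variance p pi g| <= K / Num.sqrt n%:R.
Proof.
move=> gf; set v := asymptotic_variance p pi g.
have v0 : 0 <= v := asymptotic_variance_ge0 p_stoch pi_ge0 g.
have [C C0 hC] := centered_Ustat_linearization.
have [D D0 hD] := visit_sqdev_sqr_moment p_stoch p_irr pi_ge0 pi_sum1 pi_inv x0.
have [B B0 hB] := fin_bound (transition p g).
pose c0 := \sum_x pi x * g x ^+ 2.
have c00 : 0 <= c0 by apply: sumr_ge0 => x _; rewrite mulr_ge0 ?sqr_ge0.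
pose E := 2 * (C + B) ^+ 2 * (1 + D).
have E0 : 0 <= E by rewrite !mulr_ge0 ?exprn_ge0 ?addr_ge0.
exists (2 * (c0 + v) + 2 * E) => n n1.
have n0 : 0 < n%:R :> R by rewrite ltr0n ltnW.
pose M s := path_sum f s + transition p g (last x0 s).
pose r s := n%:R * (U s - path_exp p pi n U) - M s.
have Er : path_exp p pi n (fun s => r s ^+ 2) <= E.
  apply: (@le_trans _ _ (path_exp p pi n (fun s =>
      2 * (C + B) ^+ 2 * (1 + (n%:R ^+ 2)^-1 * V s ^+ 2)))).
    apply: le_path_exp_size => s sn; pose y := V s / n%:R.
    have y0 : 0 <= y by rewrite divr_ge0 ?visit_sqdev_ge0.
    have -> : (n%:R ^+ 2)^-1 * V s ^+ 2 = y ^+ 2 by rewrite /y expr_div_n mulrC.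
    have rC : `|r s| <= (C + B) * (1 + y).
      have -> : r s = (n%:R * (U s - path_exp p pi n U) - path_sum f s)
        - transition p g (last x0 s) by rewrite /r /M; ring.
      apply: (le_trans (ler_normB _ _)); have := hC n n1 s sn.
      by have := hB (last x0 s); have := mulr_ge0 B0 y0; rewrite -/y; lra.
    rewrite -[r s ^+ 2]real_normK ?num_real//.
    apply: (@le_trans _ _ (((C + B) * (1 + y)) ^+ 2)).
      by rewrite lerXn2r// nnegrE ?mulr_ge0 ?addr_ge0.
    have -> : 2 * (C + B) ^+ 2 * (1 + y ^+ 2) = (C + B) ^+ 2 * (2 * (1 + y ^+ 2)) by ring.
    rewrite exprMn ler_wpM2l ?sqr_ge0//.
    by have := sqr_ge0 (1 - y); lra.
  rewrite path_expZ ler_wpM2l ?mulr_ge0 ?exprn_ge0 ?addr_ge0// path_expD.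
  rewrite (path_exp_cst p_stoch pi_sum1 x0) lerD2l path_expZ.
  by rewrite ler_pdivrMl ?exprn_gt0// mulrC hD// ltnW.
have EM : path_exp p pi n (fun s => M s ^+ 2) = c0 + (n%:R - 1) * v.
  case: n n1 {n0 r Er} => // n _; rewrite /M.
  by rewrite (path_exp_martingale_sqr p_stoch pi_inv x0 gf) -natr1 addrK.
(* Weight in [2 * |M * r| <= q * M ^+ 2 + q^-1 * r ^+ 2]: as [M ^+ 2] has mean of order [n] and
   [r ^+ 2] a bounded one, this choice balances the two terms. *)
pose q := (Num.sqrt n%:R)^-1 : R.
have sn0 : 0 < Num.sqrt n%:R :> R by rewrite sqrtr_gt0.
have q0 : 0 < q by rewrite invr_gt0.
have n1R : 1 <= n%:R :> R by rewrite ler1n ltnW.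
have qn : n%:R * q ^+ 2 = 1 by rewrite exprVn sqr_sqrtr ?ler0n// divff ?gt_eqF.
have q1 : q <= 1 by rewrite invf_le1// -{1}sqrtr1 ler_wsqrtr.
pose A := path_exp p pi n (fun s => (M s + r s) ^+ 2).
have -> : n%:R * path_exp p pi n (fun s => (U s - path_exp p pi n U) ^+ 2) = A / n%:R.
  apply: (mulIf (x := n%:R)); first by rewrite gt_eqF.
  rewrite divfK ?gt_eqF// mulrAC -expr2 -path_expZ; apply: eq_path_exp => s.
  by rewrite /r; ring.
have cross : `|A - path_exp p pi n (fun s => M s ^+ 2)| <=
    q * path_exp p pi n (fun s => M s ^+ 2) + (1 + q^-1) * path_exp p pi n (fun s => r s ^+ 2).
  rewrite -path_expN -path_expD -!path_expZ -path_expD.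
  apply: (le_trans (normr_path_exp _ _)); apply: le_path_exp => // s.
  have qM : 0 <= q * (M s - q^-1 * r s) ^+ 2 by rewrite mulr_ge0 ?sqr_ge0 ?(ltW q0).
  have qM' : 0 <= q * (M s + q^-1 * r s) ^+ 2 by rewrite mulr_ge0 ?sqr_ge0 ?(ltW q0).
  have e1 : q * (M s - q^-1 * r s) ^+ 2 = q * M s ^+ 2 - 2 * (M s * r s) + q^-1 * r s ^+ 2.
    by field; rewrite gt_eqF.
  have e2 : q * (M s + q^-1 * r s) ^+ 2 = q * M s ^+ 2 + 2 * (M s * r s) + q^-1 * r s ^+ 2.
    by field; rewrite gt_eqF.
  have r2 := sqr_ge0 (r s).
  by rewrite ler_norml; apply/andP; split; lra.
rewrite -[_ / Num.sqrt _]/(_ * q).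
rewrite EM in cross.
have qi : q^-1 = n%:R * q by apply: (mulIf (x := q)); rewrite ?gt_eqF// mulVf ?gt_eqF// -mulrA.
have An : `|A / n%:R - v| <= (`|A - (c0 + (n%:R - 1) * v)| + `|c0 - v|) / n%:R.
  have -> : A / n%:R - v = (A - (c0 + (n%:R - 1) * v) + (c0 - v)) / n%:R.
    by field; rewrite gt_eqF.
  by rewrite normrM normfV (gtr0_norm n0) ler_wpM2r ?invr_ge0 ?(ltW n0)// ler_normD.
apply: (le_trans An); rewrite ler_pdivrMr//.
have c0v : `|c0 - v| <= c0 + v by rewrite ler_norml; apply/andP; split; lra.
have nq : 1 <= n%:R * q by rewrite -qi invf_ge1.
have hE : (1 + q^-1) * path_exp p pi n (fun s => r s ^+ 2) <= 2 * (n%:R * q) * E.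
  rewrite ler_pM// ?addr_ge0 ?invr_ge0 ?(ltW q0)//.
    by apply: path_exp_ge0 => // s; exact: sqr_ge0.
  by rewrite qi; lra.
have hM : q * (c0 + (n%:R - 1) * v) <= n%:R * q * (c0 + v).
  rewrite [n%:R * q]mulrC -mulrA ler_wpM2l ?(ltW q0)//.
  by have := ler_wpM2r c00 n1R; lra.
have hc : c0 + v <= n%:R * q * (c0 + v) by rewrite ler_peMl// addr_ge0.
have -> : (2 * (c0 + v) + 2 * E) * q * n%:R =
  n%:R * q * (c0 + v) + n%:R * q * (c0 + v) + 2 * (n%:R * q) * E by ring.
lra.
Qed.

Lemma Ustat_variance_cvg (g : S -> R) : (forall x, g x - transition p g x = f x) ->
  (fun n => n%:R * path_exp p pi n (fun s => (U s - path_exp p pi n U) ^+ 2)) @ \oo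
    --> asymptotic_variance p pi g.
Proof.
move=> /Ustat_variance_rate[K hK]; apply/cvgrPdist_le => e e0; near=> n.
have n1 : (1 < n)%N by near: n; exact: nbhs_infty_gt.
rewrite distrC; apply: (le_trans (hK n n1)).
have n0 : 0 < n%:R :> R by rewrite ltr0n ltnW.
rewrite ler_pdivrMr ?sqrtr_gt0// mulrC -ler_pdivrMr//.
apply: (le_trans (ler_norm _)); rewrite -sqrtr_sqr ler_wsqrtr//.
near: n; exact: nbhs_infty_ger.
Unshelve. all: by end_near. Qed.

Context (a : nat -> R).
Hypothesis a_gt0 : forall n, 0 < a n.
Hypothesis a_small : (fun n => a n / n%:R) @ \oo --> (0 : R).
Hypothesis a_large : (fun n => n%:R / a n ^+ 2) @ \oo --> (0 : R).

Local Notation speed := (fun n => a n ^+ 2 / n%:R).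

Lemma a_small_near (e : R) : 0 < e -> \forall n \near \oo, a n / n%:R <= e.
Proof.
move=> e0; near=> n; apply: (le_trans (ler_norm _)).
near: n; move/cvgrPdist_le : a_small => /(_ e e0).
by apply: filterS => n; rewrite sub0r normrN.
Unshelve. all: by end_near. Qed.

Lemma speed_infty : speed @ \oo --> +oo.
Proof.
apply/cvgryPge => K; have K1 : 0 < `|K| + 1 by rewrite ltr_wpDl.
near=> n.
have n0 : 0 < n%:R :> R by rewrite ltr0n; near: n; exact: nbhs_infty_gt.
apply: (@le_trans _ _ (`|K| + 1)); first by rewrite (le_trans (ler_norm K))// lerDl.
have : n%:R / a n ^+ 2 <= (`|K| + 1)^-1.
  apply: (le_trans (ler_norm _)); near: n.
  move/cvgrPdist_le : a_large => /(_ (`|K| + 1)^-1); rewrite invr_gt0 => /(_ K1).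
  by apply: filterS => n; rewrite sub0r normrN.
rewrite ler_pdivrMr ?exprn_gt0// ler_pdivlMl// => h1.
by rewrite ler_pdivlMr.
Unshelve. all: by end_near. Qed.

Lemma speed_near (K : R) : \forall n \near \oo, K <= speed n.
Proof. by move/cvgryPge : speed_infty; exact. Qed.

Lemma a_large_near (K : R) : \forall n \near \oo, K <= a n.
Proof.
near=> n.
have n0 : 0 < n%:R :> R by rewrite ltr0n; near: n; exact: nbhs_infty_gt.
have s1 : 1 <= speed n by near: n; exact: speed_near.
apply: (le_trans (ler_norm K)); rewrite -(@ler_pXn2r _ 2)// ?nnegrE ?(ltW (a_gt0 n))//.
rewrite ler_pdivlMr// mul1r in s1; apply: le_trans s1.
near: n; exact: nbhs_infty_ger.
Unshelve. all: by end_near. Qed.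

Definition lin_path (n : nat) (s : seq S) : R := path_sum f s / a n.

Definition dev_path (n : nat) (s : seq S) : R := n%:R / a n * (U s - path_exp p pi n U).

Lemma lin_path_laplace (g : S -> R) (C t0 : R) : 0 <= C -> 0 < t0 ->
  (forall (t : R) n, (0 < n)%N -> `|t| <= t0 ->
      expR (n%:R * (t ^+ 2 / 2 * asymptotic_variance p pi g - C * `|t| ^+ 3) - C)
        <= path_exp p pi n (fun s => expR (t * path_sum f s))
        <= expR (n%:R * (t ^+ 2 / 2 * asymptotic_variance p pi g + C * `|t| ^+ 3) + C)) ->
  forall l e : R, 0 < e -> \forall n \near \oo,
    expR (speed n * (l ^+ 2 / 2 * asymptotic_variance p pi g - e))
      <= path_exp p pi n (fun s => expR (l * speed n * lin_path n s))
      <= expR (speed n * (l ^+ 2 / 2 * asymptotic_variance p pi g + e)).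
Proof.
move=> C0 t00 hL l e e0; set v := asymptotic_variance p pi g in hL *.
have l10 : 0 < `|l| + 1 by rewrite ltr_wpDl.
have L0 : 0 < C * `|l| ^+ 3 + 1 by rewrite ltr_wpDl// mulr_ge0 ?exprn_ge0.
near=> n.
have n0 : (0 < n)%N by near: n; exact: nbhs_infty_gt.
have nR : 0 < n%:R :> R by rewrite ltr0n.
have an := a_gt0 n.
have bt : a n / n%:R <= t0 / (`|l| + 1) by near: n; apply: a_small_near; rewrite divr_gt0.
have be : a n / n%:R <= e / 2 / (C * `|l| ^+ 3 + 1).
  by near: n; apply: a_small_near; rewrite !divr_gt0.
(* The error [e] is shared equally between the cubic term, through the bound on [a n / n], and the
   constant [C]. *)
have Cs : C * 2 / e <= speed n by near: n; exact: speed_near.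
pose b := a n / n%:R; have b0 : 0 < b by rewrite divr_gt0.
rewrite -/b in bt be.
have sb : speed n = n%:R * b ^+ 2 by rewrite /b; field; rewrite gt_eqF.
pose t := l * b.
have tt0 : `|t| <= t0.
  rewrite normrM (gtr0_norm b0); apply: (@le_trans _ _ ((`|l| + 1) * b)).
    by rewrite ler_wpM2r ?(ltW b0)// lerDl.
  by rewrite mulrC -ler_pdivlMr.
have s0 : 0 <= speed n by rewrite sb mulr_ge0 ?sqr_ge0.
have err : n%:R * (C * `|t| ^+ 3) + C <= speed n * e.
  have -> : n%:R * (C * `|t| ^+ 3) = speed n * (C * `|l| ^+ 3 * b).
    by rewrite /t normrM (gtr0_norm b0) sb; ring.
  rewrite ler_pdivlMr// in be; rewrite ler_pdivrMr// in Cs.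
  have h1 : C * `|l| ^+ 3 * b <= e / 2 by move: be; lra.
  have := ler_wpM2l s0 h1; lra.
have main : n%:R * (t ^+ 2 / 2 * v) = speed n * (l ^+ 2 / 2 * v) by rewrite sb /t; ring.
have -> : path_exp p pi n (fun s => expR (l * speed n * lin_path n s)) =
    path_exp p pi n (fun s => expR (t * path_sum f s)).
  apply: eq_path_exp => s; congr expR; rewrite /t /lin_path /b.
  by field; rewrite !gt_eqF.
have /andP[lo up] := hL t n n0 tt0; apply/andP; split.
  by apply: le_trans lo; rewrite ler_expR; lra.
by apply: (le_trans up); rewrite ler_expR; lra.
Unshelve. all: by end_near. Qed.

Lemma dev_lin_equiv (e K : R) : 0 < e -> \forall n \near \oo,
  fprob (fun t : n.-tuple S => path_weight p pi t)
    (fun t => e <= `|dev_path n t - lin_path n t|) <= expR (- speed n * K).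
Proof.
move=> e0.
have [C C0 hC] := centered_Ustat_linearization.
have [D D1 hD] := visit_sqdev_tail p_stoch p_irr pi_ge0 pi_sum1 pi_inv x0.
have D0 : 0 < D by apply: lt_le_trans D1.
have S0 : (0 < #|S|)%N by apply/card_gt0P; exists x0.
have SR : 0 < #|S|%:R :> R by rewrite ltr0n.
have C10 : 0 < C + 1 by rewrite ltr_wpDl.
(* Solves [#|S| * e1 * a n = e * a n / (2 * (C + 1))]: in [e * a n <= (C + 1) * (1 + V / n)], half
   of the left side absorbs the summand 1 and the other half forces [V] to be large. *)
pose e1 := e / (2 * (C + 1) * #|S|%:R).
have e10 : 0 < e1 by rewrite divr_gt0 ?mulr_gt0.
pose k := e1 / (4 * D); have k0 : 0 < k by rewrite divr_gt0// mulr_gt0.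
have K10 : 0 < `|K| + 1 by rewrite ltr_wpDl.
near=> n.
have n1 : (1 < n)%N by near: n; exact: nbhs_infty_gt.
have n0 : (0 < n)%N by exact: ltnW.
have nR : 0 < n%:R :> R by rewrite ltr0n.
have an := a_gt0 n.
have b4 : a n / n%:R <= 4 / e1 by near: n; apply: a_small_near; rewrite divr_gt0.
have bK : a n / n%:R <= k / 2 / (`|K| + 1).
  by near: n; apply: a_small_near; rewrite divr_gt0// divr_gt0.
have aC : (C + 1) * 2 / e <= a n by near: n; exact: a_large_near.
have aD : (D + 2 * #|S|%:R) * 2 / k <= a n by near: n; exact: a_large_near.
pose q := e1 * n%:R * a n.
have q0 : 0 <= q by rewrite /q mulr_ge0 ?(ltW an)// mulr_ge0 ?(ltW e10).
have q4 : q <= 4 * n%:R ^+ 2.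
  have -> : q = (a n / n%:R) * e1 * n%:R ^+ 2 by rewrite /q; field; rewrite gt_eqF.
  by rewrite ler_wpM2r ?sqr_ge0// -ler_pdivlMr.
apply: (@le_trans _ _ (fprob (fun t : n.-tuple S => path_weight p pi t)
    (fun t => #|S|%:R * q <= V t))).
  apply: le_fprob => t; first exact: path_weight_ge0.
  have -> : dev_path n t - lin_path n t =
      (n%:R * (U t - path_exp p pi n U) - path_sum f t) / a n.
    by rewrite /dev_path /lin_path; ring.
  rewrite normrM normfV (gtr0_norm an) ler_pdivlMr// => he.
  have := le_trans he (hC n n1 t (size_tuple t)).
  have y0 : 0 <= V t / n%:R by rewrite divr_ge0 ?visit_sqdev_ge0.
  move=> h1; have {h1} : e * a n <= (C + 1) * (1 + V t / n%:R).
    by apply: (le_trans h1); rewrite ler_wpM2r ?addr_ge0// lerDl.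
  rewrite ler_pdivrMr// in aC => h1.
  have h2 : (e / 2 * a n) / (C + 1) <= V t / n%:R.
    by rewrite ler_pdivrMr//; lra.
  rewrite ler_pdivlMr// in h2; apply: le_trans h2.
  rewrite le_eqVlt; apply/orP; left; apply/eqP; rewrite /q /e1.
  by field; rewrite !gt_eqF.
apply: (le_trans (hD n q n0 q0 q4)).
have -> : q / (4 * D * n%:R) = k * a n by rewrite /q /k; field; rewrite !gt_eqF.
apply: (@le_trans _ _ (expR (2 * #|S|%:R) * expR (D - k * a n))).
  rewrite ler_wpM2r ?expR_ge0//; apply: le_trans (expR_ge1Dx _).
  by rewrite lerDr.
rewrite -expRD ler_expR.
have h1 : speed n * K <= k / 2 * a n.
  apply: (@le_trans _ _ (speed n * (`|K| + 1))).
    rewrite ler_wpM2l ?divr_ge0 ?sqr_ge0//.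
    by rewrite (le_trans (ler_norm K))// lerDl.
  have -> : speed n * (`|K| + 1) = (a n / n%:R) * (`|K| + 1) * a n by ring.
  by rewrite ler_wpM2r ?(ltW an)// -ler_pdivlMr.
rewrite ler_pdivrMr// in aD.
lra.
Unshelve. all: by end_near. Qed.

End UstatModerateDeviations.

(** * Law of the trajectories *)

Section PathLaw.
Context (R : realType) (d : measure_display) (Omega : measurableType d).
Context (P : probability Omega R) (S : finType) (X : nat -> Omega -> S) (p : S -> S -> R).
Hypothesis X_markov : markov_chain P X p.
Hypothesis X_stationary : strictly_stationary P X.
Context (x0 : S).

Definition initial_law (x : S) : R := fine (P (X 0%N @^-1` [set x])).

Local Notation pi := initial_law.

Definition trajectory (n : nat) (w : Omega) : seq S := mkseq (X^~ w) n.

Lemma size_trajectory n w : size (trajectory n w) = n.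
Proof. exact: size_mkseq. Qed.

Lemma trajectoryS n w : trajectory n.+1 w = rcons (trajectory n w) (X n w).
Proof. by rewrite /trajectory /mkseq -addn1 iotaD map_cat cats1. Qed.

Lemma trajectory_eqP s w :
  trajectory (size s) w = s <-> forall i, (i < size s)%N -> X i w = nth x0 s i.
Proof.
split=> [<- i|h].
  by rewrite size_trajectory => hi; rewrite nth_mkseq.
apply: (@eq_from_nth _ x0); rewrite size_trajectory// => i hi.
by rewrite nth_mkseq// h.
Qed.

Lemma trajectoryS_eq s y :
  [set w | trajectory (size s).+1 w = rcons s y] =
  [set w | trajectory (size s) w = s] `&` (X (size s) @^-1` [set y]).
Proof.
apply/seteqP; split=> w /=; rewrite trajectoryS.
  by move=> /eqP; rewrite eqseq_rcons => /andP[/eqP -> /eqP ->].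
by move=> [-> ->].
Qed.

Lemma measurable_trajectory s : measurable [set w | trajectory (size s) w = s].
Proof.
have [Xdisc _ _] := X_markov.
elim/last_ind: s => [|s y IH].
  by rewrite (_ : [set w | _] = setT)//; apply/seteqP; split.
by rewrite size_rcons trajectoryS_eq; apply: measurableI.
Qed.

Lemma initial_lawE x : P (X 0%N @^-1` [set x]) = (pi x)%:E.
Proof. by rewrite fineK// fin_num_measure//; have [Xdisc _ _] := X_markov; exact: Xdisc. Qed.

Lemma path_lawE s : P [set w | trajectory (size s) w = s] = (path_weight p pi s)%:E.
Proof.
have [Xdisc _ Xp] := X_markov.
elim/last_ind: s => [|s y IH].
  rewrite (_ : [set w | _] = setT) ?probability_setT//.
  by apply/seteqP; split.
rewrite size_rcons trajectoryS_eq; case: (posnP (size s)) => [/size0nil ->|s0].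
  rewrite /= mulr1 -initial_lawE; congr (P _).
  by apply/seteqP; split => w /=; [case|].
rewrite (path_weight_rcons x0)// EFinM -IH.
have last_s : last x0 s = nth x0 s (size s).-1 by rewrite nth_last.
have sE := prednK s0.
have := Xp (size s).-1 (nth x0 s) y; rewrite -last_s sE => Hp.
rewrite -[RHS](_ : (P [set w | forall i, (i <= (size s).-1)%N -> X i w = nth x0 s i] *
  (p (last x0 s) y)%:E)%E = _).
  rewrite -Hp; congr (P _); apply/seteqP; split=> w /= [h1 h2]; split=> //.
    by move=> i hi; move/trajectory_eqP : h1; apply; rewrite -sE ltnS.
  by apply/trajectory_eqP => i hi; apply: h1; rewrite -ltnS sE.
congr (P _ * _)%E; apply/seteqP; split=> w /=.
  by move=> h1; apply/trajectory_eqP => i hi; apply: h1; rewrite -ltnS sE.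
by move=> /trajectory_eqP h1 i hi; apply: h1; rewrite -sE ltnS.
Qed.

(** A functional of [n] states takes finitely many values; as a finite combination of indicators it
    is integrable, with expectation a sum over tuples. *)
Lemma trajectory_indicator n (F : seq S -> R) w :
  F (trajectory n w) =
  \sum_(t : n.-tuple S) F t * \1_[set w | trajectory n w = t] w.
Proof.
pose t0 : n.-tuple S := Tuple (introT eqP (size_trajectory n w)).
rewrite (bigD1 t0)//= indicE mem_set//= mulr1 big1 ?addr0// => t tt0.
rewrite indicE memNset ?mulr0//= => h; move/eqP: tt0; apply.
by apply: val_inj.
Qed.

Lemma measurable_trajectory_eq n (t : n.-tuple S) :
  measurable [set w | trajectory n w = t].
Proof. by have := measurable_trajectory t; rewrite size_tuple. Qed.

Lemma expectation_trajectory n (F : seq S -> R) :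
  ('E_P[fun w => F (trajectory n w)])%E = (path_exp p pi n F)%:E.
Proof.
rewrite expectation.unlock.
under eq_integral do rewrite (trajectory_indicator n F) -sumEFin.
under eq_integral do under eq_bigr do rewrite EFinM.
have mt := @measurable_trajectory_eq n.
rewrite (integral_sum _ (f := fun (t : n.-tuple S) w =>
  ((F t)%:E * (\1_[set w | trajectory n w = t] w)%:E)%E)) //.
  rewrite /path_exp /fexp -sumEFin; apply: eq_bigr => t _.
  rewrite integralZl//; last by exact: integrable_indic (mt t).
  rewrite integral_indic// setIT muleC EFinM -path_lawE.
  by rewrite size_tuple.
move=> t; apply: integrableZl => //; exact: integrable_indic (mt t).
Qed.

Lemma probability_trajectory n (B : pred (seq S)) :
  P [set w | B (trajectory n w)] =
    (fprob (fun t : n.-tuple S => path_weight p pi t) (fun t => B t))%:E.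
Proof.
have mB : measurable [set w | B (trajectory n w)].
  rewrite (_ : [set w | _] =
      \bigcup_(t in [set t : n.-tuple S | B t]) [set w | trajectory n w = t]).
    by apply: fin_bigcup_measurable => [|t _]; [exact: finite_finset|
      exact: measurable_trajectory_eq].
  apply/seteqP; split=> w /= => [Bw|[t /= Bt ->]//].
  by exists (Tuple (introT eqP (size_trajectory n w))).
rewrite -expectation_indic// fprobE -[RHS](expectation_trajectory n (fun s => (B s)%:R)).
congr ('E_P[_])%E; apply/funext => w; rewrite indicE.
by case: (boolP (B _)) => Bw; [rewrite mem_set|rewrite memNset//; apply/negP].
Qed.

Lemma initial_law_ge0 x : 0 <= pi x.
Proof. by rewrite fine_ge0. Qed.

Lemma sum_initial_law : \sum_x pi x = 1.
Proof.
have := expectation_trajectory 1 (fun=> 1); rewrite (path_exp1 _ _ x0).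
under [in X in _ = X]eq_bigr do rewrite mulr1.
by rewrite (expectation_cst P 1) => -[].
Qed.

Lemma initial_law_invariant y : \sum_x pi x * p x y = pi y.
Proof.
apply: EFin_inj.
transitivity (P (X 1%N @^-1` [set y])).
  have := probability_trajectory 2 (fun s => last x0 s == y).
  rewrite fprobE -[X in _ = X%:E -> _]/(path_exp p pi 2 (fun s => (last x0 s == y)%:R)).
  rewrite (path_expS _ _ x0) (path_exp1 _ _ x0) => E.
  rewrite (_ : X 1%N @^-1` [set y] = [set w | last x0 (trajectory 2 w) == y]); last first.
    by apply/seteqP; split=> w /= /eqP.
  rewrite E; congr EFin; apply: eq_bigr => x _; congr (_ * _).
  rewrite /transition /= (bigD1 y)//= eqxx mulr1 big1 ?addr0// => z /negPf ->.
  by rewrite mulr0.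
have := X_stationary 1 (fun _ : 'I_1 => 0%N) (fun=> y); rewrite -initial_lawE => H.
rewrite (_ : X 1%N @^-1` [set y] = [set w | forall i : 'I_1, X (0 + 1)%N w = y]).
  rewrite H; congr (P _); apply/seteqP; split=> w /= => [h|h i]; last exact: h.
  exact: h ord0.
by apply/seteqP; split=> w /= => [h i|h]; [exact: h|exact: h ord0].
Qed.

End PathLaw.

(** * Transfer of the path estimates to the process *)

Lemma Ustat_trajectory (R : realType) (d : measure_display) (Omega : measurableType d)
    (S : finType) (X : nat -> Omega -> S) (x0 : S) (h : S -> S -> R) n w :
  Ustat h X n w = path_Ustat x0 h (trajectory X n w).
Proof.
rewrite /path_Ustat size_trajectory /Ustat; congr (_ * _).
apply: eq_bigr => i _; apply: eq_bigr => j _.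
by rewrite !nth_mkseq.
Qed.

Unset Implicit Arguments.
Set Strict Implicit.
Set Printing Implicit Defensive.

Theorem corollary3p5 (R : realType) (d : measure_display)
    (Omega : measurableType d) (P : probability Omega R) (S : finType)
    (X : nat -> Omega -> S) (p : S -> S -> R) (h : S -> S -> R)
    (a : nat -> R)
    (Xmarkov : markov_chain P X p)
    (Xstationary : strictly_stationary P X)
    (Xaperiodic : aperiodic_chain p)
    (Xirreducible : irreducible_chain p)
    (h_bounded : exists M : R, forall x y, `|h x y| <= M)
    (h_symmetric : forall x y, h x y = h y x)
    (h_nondegenerate : nondegenerate_Ustat P h X)
    (a_gt0 : forall n, 0 < a n)
    (a_small : (fun n => a n / n%:R) @ \oo --> (0 : R))
    (a_large : (fun n => n%:R / a n ^+ 2) @ \oo --> (0 : R)) :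
  exists v : R,
    (fun n => ('V_P[fun w => (Num.sqrt n%:R * Ustat h X n w)%R])%E) @ \oo
      --> (v%:E : \bar R) /\
    moderate_deviation_principle
      (fun n => pushforward P (fun w =>
         n%:R / a n * (Ustat h X n w - fine ('E_P[Ustat h X n])%E)))
      (fun n => a n ^+ 2 / n%:R)
      (gaussian_rate v).
Proof.
(* A probability space is inhabited, hence so is [S]; the state [x0] serves as the default for [nth]
   and [last]. *)
have [w0 _] : exists w : Omega, True.
  apply: contrapT => hw; have := probability_setT P.
  rewrite (_ : setT = set0) ?measure0; first by move/eqP; rewrite eqe eq_sym oner_eq0.
  by apply/seteqP; split=> w // _; apply: hw; exists w.
have x0 : S := X 0%N w0.
have [_ p_stoch _] := Xmarkov.
pose pi := initial_law P X.
have pi0 : forall x, 0 <= pi x := initial_law_ge0 P X.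
have pi1 : \sum_x pi x = 1 := sum_initial_law Xmarkov x0.
have pi_inv : forall y, \sum_x pi x * p x y = pi y :=
  initial_law_invariant Xmarkov Xstationary x0.
have EP n F : ('E_P[fun w => F (trajectory X n w)])%E = (path_exp p pi n F)%:E :=
  expectation_trajectory Xmarkov x0 n F.
pose U := path_Ustat x0 h.
have UE n : Ustat h X n = fun w => U (trajectory X n w).
  by apply/funext => w; exact: Ustat_trajectory.
have meanU n : fine ('E_P[Ustat h X n])%E = path_exp p pi n U by rewrite UE EP.
have [g [C [t0 [gf C0 t00 _ hL]]]] :=
  laplace_bounds p_stoch Xirreducible pi0 pi1 pi_inv x0 (linear_part_mean h pi1).
have VE n : ('V_P[fun w => (Num.sqrt n%:R * Ustat h X n w)%R])%E =
    (n%:R * path_exp p pi n (fun s => (U s - path_exp p pi n U) ^+ 2))%:E.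
  have EsU : ('E_P[fun w => (Num.sqrt n%:R * Ustat h X n w)%R])%E =
      (Num.sqrt n%:R * path_exp p pi n U)%:E.
    by rewrite UE (EP n (fun s => Num.sqrt n%:R * U s)) path_expZ.
  rewrite /variance covariance.unlock EsU UE /=.
  pose F s := (Num.sqrt n%:R * U s - Num.sqrt n%:R * path_exp p pi n U) *
    (Num.sqrt n%:R * U s - Num.sqrt n%:R * path_exp p pi n U).
  rewrite -[LHS]/('E_P[fun w => F (trajectory X n w)])%E EP -path_expZ.
  congr EFin; apply: eq_path_exp => s.
  by rewrite /F -mulrBr mulrACA -expr2 sqr_sqrtr// -expr2.
exists (asymptotic_variance p pi g); split.
  rewrite (funext VE); apply: cvg_EFin; first by near=> n.
  exact: (Ustat_variance_cvg p_stoch Xirreducible pi0 pi1 pi_inv x0 h_symmetric gf).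
apply: (@gartner_ellis_gaussian _ (fun n => n.-tuple S : finType)
  (fun n t => path_weight p pi t) _ _ _ _ _ _
  (fun n t => lin_path pi h a n t) (fun n t => dev_path p pi x0 h a n t)).
- by move=> n t; exact: path_weight_ge0.
- by move=> n; exact: path_weight_sum1.
- exact: (speed_infty a_gt0 a_large).
- exact: (asymptotic_variance_ge0 p_stoch pi0 g).
- exact: (lin_path_laplace a_gt0 a_small a_large C0 t00 hL).
- by move=> e K; apply: dev_lin_equiv.
move=> n G mG; rewrite meanU UE.
rewrite -(probability_trajectory Xmarkov x0 n
  (fun s => `[< G (dev_path p pi x0 h a n s) >])).
by congr (P _); apply/seteqP; split=> w /= => [?|/asboolP//]; apply/asboolP.
Unshelve. all: by end_near. Qed.
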